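(* Let $K$ be a field and let $A$ be a finitely generated $K$-algebra that is a domain with $\mathrm{GKdim}(A)<3$, and let $Q(A)$ be its quotient division algebra. Suppose $$K=D_0\subseteq D_1\subseteq D_2\subseteq\cdots\subseteq D_m\subseteq Q(A)$$ is a chain of division $K$-subalgebras of $Q(A)$ such that (1) for each $i=1,\dots,m$, $D_i$ is infinite dimensional as a left $D_{i-1}$-vector space, and (2) for each $i=1,\dots,m$, $D_i$ is finitely generated as a division algebra over $K$. Then $m\le 2$.
   Context: For a finitely generated $K$-algebra $A$, $\mathrm{GKdim}(A)=\limsup_{n\to\infty}\log\dim_K(V^n)/\log n$, where $V$ is any finite-dimensional subspace containing $1$ that generates $A$ as a $K$-algebra (independent of the choice of $V$). A finitely generated domain of finite GK dimension is an Ore domain and so has a quotient division algebra $Q(A)$ (its classical ring of fractions). A division algebra $D$ is finitely generated as a division algebra if there is a finite subset $S\subseteq D$ such that the smallest division subalgebra containing $K$ and $S$ is $D$. *)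

(* Defs.v *)
From HB Require Import structures.
From mathcomp Require Import all_boot all_order all_algebra.
From mathcomp Require Import boolp classical_sets reals ereal topology sequences exp.
From mathcomp Require Import Rstruct.
Set Implicit Arguments. Unset Strict Implicit. Unset Printing Implicit Defensive.
Import Order.TTheory GRing.Theory Num.Theory.
Local Open Scope ring_scope.

Section Defs.
Variables (K : fieldType) (A : algType K).

Definition in_span (t : seq A) (a : A) : Prop :=
  exists c : seq K, size c = size t /\ a = \sum_(i < size t) c`_i *: t`_i.

Definition lin_indep (t : seq A) : Prop :=
  forall c : seq K, size c = size t ->
    \sum_(i < size t) c`_i *: t`_i = 0 -> forall i, (i < size t)%N -> c`_i = 0.

Definition dim_span (t : seq A) : nat :=
  \max_(m : (size t).-tuple bool | `[< lin_indep (mask m t) >]) count id m.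

(* a finite list spanning V^n, where V = span v: all products of n elements of v *)
Definition pow_span (v : seq A) (n : nat) : seq A :=
  [seq \prod_(i < n) v`_(f i) | f : {ffun 'I_n -> 'I_(size v)} <- enum {: {ffun 'I_n -> 'I_(size v)}}].

Definition dim_pow (v : seq A) (n : nat) : nat := dim_span (pow_span v n).

Definition is_subalg (S : A -> Prop) : Prop :=
  S 1 /\ (forall x y, S x -> S y -> S (x + y)) /\ (forall x y, S x -> S y -> S (x * y))
  /\ (forall (k : K) x, S x -> S (k *: x)).

Definition generates (v : seq A) : Prop :=
  forall S : A -> Prop, is_subalg S -> (forall x, in_span v x -> S x) -> forall a, S a.

Definition finitely_generated_alg : Prop := exists v : seq A, generates v.

Definition GKdim_wrt (v : seq A) : \bar Rdefinitions.R :=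
  limn_esup (fun n : nat => ((ln ((dim_pow v n)%:R : Rdefinitions.R)) / ln (n%:R : Rdefinitions.R))%:E).

Definition is_domain : Prop := forall a b : A, a * b = 0 -> a = 0 \/ b = 0.
End Defs.

Section DivDefs.
Variables (K : fieldType) (D : unitAlgType K).

Definition is_division_ring : Prop := forall x : D, x != 0 -> x \is a GRing.unit.

Definition is_divsubalg (S : D -> Prop) : Prop :=
  (forall k : K, S (k%:A)) /\ (forall x y, S x -> S y -> S (x + y))
  /\ (forall x, S x -> S (- x)) /\ (forall x y, S x -> S y -> S (x * y))
  /\ (forall x, S x -> x != 0 -> S (x^-1)).

Definition left_findim (F E : D -> Prop) : Prop :=
  exists s : seq D, (forall j, (j < size s)%N -> E s`_j) /\
    forall x, E x -> exists c : seq D, size c = size s /\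
      (forall j, (j < size s)%N -> F c`_j) /\ x = \sum_(j < size s) c`_j * s`_j.

Definition fg_division_alg (E : D -> Prop) : Prop :=
  is_divsubalg E /\ exists S : seq D, (forall x, x \in S -> E x) /\
    forall F : D -> Prop, is_divsubalg F -> (forall x, x \in S -> F x) ->
      forall x, E x -> F x.

Definition is_quotient_division_alg (A : algType K) (f : {lrmorphism A -> D}) : Prop :=
  is_division_ring /\ injective f /\
  forall d : D, exists a s : A, f s != 0 /\ d = f a * (f s)^-1.
End DivDefs.

(* Main.v *)
(** Suppose the chain contains [E1 < E2 < E3].  Let [U n] be the image of [V^n] in
    the division algebra, [d n] its dimension, and [s] an element of the algebra
    such that [w * s] lies in [U k] for [w = 1] and for the generators [w] of [E1]
    and [E2]; thus each such [w] maps [s * U n] into [U (n + k)].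

    Upper bound on ranks: since [E1] is finitely generated and infinite dimensional
    over [K], a finite-dimensional space of left [E1]-rank [r] grows by at least [r]
    dimensions under [1] and the generators of [E1]; so the [E1]-rank of [s * U m]
    is at most [d (m + k) - d m].

    Lower bound on ranks: let [p * (d (n + k) - d n) < d n].  By counting equations
    over [K[X]] there are nonzero polynomials [y_0, ..., y_p] with coefficients in
    [s * U n] and [y_(i+1) = b_i * y_i], where the [b_i] are prescribed combinations
    over [K[X]] of [1] and the generators of [E2].  For generic [b_i] the products
    [b_(i-1) ... b_0] are left independent over [E1[X]], because [E2] is infinite
    over [E1].  As [E3] is infinite over [E2], there are [n + 1] elements of [U n]
    that keep left [E2]-independence after multiplication by the leading coefficient
    of [y_0].  Together these produce [(p + 1) * (n + 1)] left [E1]-independent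
    vectors in [s * U (2 * n)].

    Hence [(n + 1) * d n <= (d (m + k) - d m) * (d (n + k) - d n)] for [m >= 2 * n],
    and summing over a box of pairs [(m, n)] shows that [d] grows at least cubically,
    which contradicts [GKdim < 3]. *)

Require Import Defs.
From HB Require Import structures.
From mathcomp Require Import all_boot all_order all_algebra.
From mathcomp Require Import boolp classical_sets reals ereal topology sequences exp.
From mathcomp Require Import Rstruct.
From mathcomp Require Import zify lra.
Import Order.TTheory GRing.Theory Num.Theory.
Local Open Scope ring_scope.

Set Implicit Arguments.
Unset Strict Implicit.
Unset Printing Implicit Defensive.

(** * Linear algebra over a left Ore subring of a domain *)

Definition nzd (R : nzRingType) : Prop :=
  forall x y : R, x * y = 0 -> x = 0 \/ y = 0.

Definition subring_pred (R : nzRingType) (P : R -> Prop) : Prop :=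
  [/\ P 1, (forall x y, P x -> P y -> P (x - y))
    & (forall x y, P x -> P y -> P (x * y))].

Definition left_ore (R : nzRingType) (P : R -> Prop) : Prop :=
  forall x y, P x -> P y -> y != 0 ->
    exists a b, [/\ P a, P b, a != 0 & a * x = b * y].

Section SubringPred.
Variables (R : nzRingType) (P : R -> Prop).
Hypothesis subP : subring_pred P.

Lemma subring_pred1 : P 1. Proof. by case: subP. Qed.
Lemma subring_predB x y : P x -> P y -> P (x - y).
Proof. by case: subP => _ h _; apply: h. Qed.
Lemma subring_predM x y : P x -> P y -> P (x * y).
Proof. by case: subP => _ _ h; apply: h. Qed.
Lemma subring_pred0 : P 0.
Proof. by rewrite -(subrr 1); apply: subring_predB; apply: subring_pred1. Qed.
Lemma subring_predN x : P x -> P (- x).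
Proof. by rewrite -sub0r; apply: subring_predB; apply: subring_pred0. Qed.
Lemma subring_predD x y : P x -> P y -> P (x + y).
Proof. by move=> px py; rewrite -(opprK y); apply: subring_predB => //; apply: subring_predN. Qed.
Lemma subring_pred_sum (I : Type) (r : seq I) (Q : pred I) (F : I -> R) :
  (forall i, Q i -> P (F i)) -> P (\sum_(i <- r | Q i) F i).
Proof. by move=> h; apply: big_ind => //; [exact: subring_pred0 | exact: subring_predD]. Qed.
End SubringPred.

Section LeftOreLinearAlgebra.
Variables (R : nzRingType) (P : R -> Prop).
Hypotheses (domR : nzd R) (subP : subring_pred P) (oreP : left_ore P).

Lemma nzd_mulf_neq0 x y : x != 0 -> y != 0 -> x * y != 0 :> R.
Proof. by move=> /eqP x0 /eqP y0; apply/eqP => /domR []. Qed.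

(** Fraction-free Gaussian elimination: a row with nonzero last entry clears the last column of the
    other rows through common left multiples. If the last column is zero, one row is simply
    dropped. *)
Lemma ore_dependent_ord m (F : 'I_m.+1 -> 'I_m -> R) :
  (forall i j, P (F i j)) ->
  exists c : 'I_m.+1 -> R, [/\ forall i, P (c i), exists i, c i != 0
    & forall j, \sum_i c i * F i j = 0].
Proof.
elim: m F => [|m IH] F PF.
  exists (fun=> 1); split; first by move=> _; exact: subring_pred1.
    by exists ord0; exact: oner_neq0.
  by case.
have [[i0 Fi0]|nz] := pselect (exists i, F i ord_max != 0); last first.
  have z i : F i ord_max = 0.
    by apply/eqP/negP => /negP h; apply: nz; exists i.
  have [c [Pc [i1 ci1] cF]] := IH (fun i j => F (lift ord0 i) (lift ord_max j))
    (fun i j => PF _ _).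
  exists (fun i => if unlift ord0 i is Some k then c k else 0); split.
  - move=> i; case: unliftP => [k _|_]; [exact: Pc | exact: (subring_pred0 subP)].
  - by exists (lift ord0 i1); rewrite liftK.
  - move=> j; rewrite big_ord_recl unlift_none mul0r add0r.
    case: (unliftP ord_max j) => [k ->|->].
      by rewrite -[RHS](cF k); apply: eq_bigr => i _; rewrite liftK.
    by rewrite big1 // => i _; rewrite z mulr0.
have /choice [ab abP] i : exists ab : R * R, [/\ P ab.1, P ab.2, ab.1 != 0
    & ab.1 * F (lift i0 i) ord_max = ab.2 * F i0 ord_max].
  by have [a [b [? ? ? ?]]] := oreP (PF (lift i0 i) ord_max) (PF i0 ord_max) Fi0;
    exists (a, b).
have [c [Pc [i1 ci1] cF]] := IH
  (fun i j => (ab i).1 * F (lift i0 i) (lift ord_max j) - (ab i).2 * F i0 (lift ord_max j))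
  (fun i j => let: And4 pa pb _ _ := abP i in
     subring_predB subP (subring_predM subP pa (PF _ _)) (subring_predM subP pb (PF _ _))).
exists (fun i => if unlift i0 i is Some k then c k * (ab k).1
                 else - \sum_k c k * (ab k).2); split.
- move=> i; case: unliftP => [k _|_].
    by case: (abP k) => pa _ _ _; exact: subring_predM.
  apply: subring_predN => //; apply: subring_pred_sum => // k _.
  by case: (abP k) => _ pb _ _; exact: subring_predM.
- exists (lift i0 i1); rewrite liftK; apply: nzd_mulf_neq0 => //.
  by case: (abP i1).
- move=> j; rewrite (bigD1_ord i0) //= unlift_none mulNr mulr_suml addrC.
  apply/eqP; rewrite subr_eq0; apply/eqP.
  under eq_bigr do rewrite liftK.
  case: (unliftP ord_max j) => [k ->|->].
    have /= := cF k; under eq_bigr do rewrite mulrBr !mulrA.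
    by rewrite sumrB => /eqP; rewrite subr_eq0 => /eqP.
  apply: eq_bigr => i _; case: (abP i) => _ _ _ e.
  by rewrite -!mulrA e.
Qed.

Lemma ore_dependent (I J : finType) (F : I -> J -> R) :
  (#|J| < #|I|)%N -> (forall i j, P (F i j)) ->
  exists c : I -> R, [/\ forall i, P (c i), exists i, c i != 0
    & forall j, \sum_i c i * F i j = 0].
Proof.
move=> JI PF; pose g (i : 'I_#|J|.+1) : I := enum_val (widen_ord JI i).
have g_inj : injective g.
  by move=> i i' /enum_val_inj /(congr1 val) /= e; apply: val_inj.
have [c [Pc [i1 ci1] cF]] := ore_dependent_ord
  (fun i j => PF (g i) (enum_val j)).
exists (fun x => if [pick i | g i == x] is Some i then c i else 0).
have gK i : [pick k | g k == g i] = Some i.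
  case: pickP => [k /eqP /g_inj -> //|/(_ i)]; by rewrite eqxx.
split.
- by move=> x; case: pickP => *; [exact: Pc | exact: (subring_pred0 subP)].
- by exists (g i1); rewrite gK.
- move=> j; rewrite -[RHS](cF (enum_rank j)).
  rewrite (bigID (mem (codom g))) /= [X in _ + X]big1 ?addr0; last first.
    move=> x gx; case: pickP => [i /eqP e|_]; last by rewrite mul0r.
    by rewrite -e codom_f in gx.
  rewrite (reindex_onto g (fun x => odflt ord0 [pick i | g i == x])) /=.
    by apply: eq_big => [i|i _]; rewrite ?codom_f gK /= ?eqxx ?enum_rankK.
  by move=> x /codomP[i ->]; rewrite gK.
Qed.

Definition lfree n (e : nat -> R) : Prop :=
  forall c : nat -> R, (forall i, P (c i)) -> \sum_(i < n) c i * e i = 0 ->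
    forall i, (i < n)%N -> c i = 0.

(** Stands for membership in the left span over the skew field of fractions of [P]; carrying the
    denominator [f] along avoids constructing the localization. *)
Definition lclosure n (e : nat -> R) (y : R) : Prop :=
  exists f c, [/\ P f, (forall i : nat, P (c i)), f != 0
    & f * y = \sum_(i < n) c i * e i].

Lemma lfree_ext n e e' : (forall i, (i < n)%N -> e i = e' i) -> lfree n e -> lfree n e'.
Proof.
move=> ee he c Pc s0; apply: he => //; rewrite -[RHS]s0.
by apply: eq_bigr => i _; rewrite ee.
Qed.

Lemma lclosure_ext n e e' y :
  (forall i, (i < n)%N -> e i = e' i) -> lclosure n e y -> lclosure n e' y.
Proof.
move=> ee [f [c [Pf Pc f0 ey]]]; exists f, c; split => //; rewrite ey.
by apply: eq_bigr => i _; rewrite ee.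
Qed.

Lemma lclosure_gen n e i : (i < n)%N -> lclosure n e (e i).
Proof.
move=> i_n; exists 1, (fun j => if j == i then 1 else 0); split.
- exact: subring_pred1.
- by move=> j; case: ifP => _; [exact: subring_pred1 | exact: (subring_pred0 subP)].
- exact: oner_neq0.
- rewrite mul1r (bigD1 (Ordinal i_n)) //= eqxx mul1r big1 ?addr0 // => j.
  by rewrite -val_eqE /= => /negPf ->; rewrite mul0r.
Qed.

Lemma lclosure0 n e : lclosure n e 0.
Proof.
exists 1, (fun=> 0); split; [exact: subring_pred1| | exact: oner_neq0 |].
  by move=> _; exact: (subring_pred0 subP).
by rewrite mulr0 big1 // => i _; rewrite mul0r.
Qed.

Lemma lclosureB n e y z : lclosure n e y -> lclosure n e z -> lclosure n e (y - z).
Proof.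
move=> [f [c [Pf Pc f0 ey]]] [g [d [Pg Pd g0 ez]]].
have [a [b [Pa Pb a0 ab]]] := oreP Pf Pg g0.
exists (a * f), (fun i => a * c i - b * d i); split.
- exact: subring_predM.
- by move=> i; apply: subring_predB => //; apply: subring_predM.
- exact: nzd_mulf_neq0.
- rewrite mulrBr {2}ab -!mulrA ey ez !mulr_sumr -sumrB.
  by apply: eq_bigr => i _; rewrite mulrBl !mulrA.
Qed.

Lemma lclosureD n e y z : lclosure n e y -> lclosure n e z -> lclosure n e (y + z).
Proof.
move=> hy hz; rewrite -(opprK z) -[- z]sub0r; apply: lclosureB => //.
by apply: lclosureB => //; exact: lclosure0.
Qed.

(** The Ore condition moves the denominator past [d]: from [a * d = b * f], the factor [a] is a
    denominator for [d * y]. *)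
Lemma lclosureM n e d y : P d -> lclosure n e y -> lclosure n e (d * y).
Proof.
move=> Pd [f [c [Pf Pc f0 ey]]].
have [a [b [Pa Pb a0 ab]]] := oreP Pd Pf f0.
exists a, (fun i => b * c i); split => //.
  by move=> i; apply: subring_predM.
rewrite mulrA ab -mulrA ey mulr_sumr.
by apply: eq_bigr => i _; rewrite mulrA.
Qed.

Lemma lclosure_div n e g y : P g -> g != 0 -> lclosure n e (g * y) -> lclosure n e y.
Proof.
move=> Pg g0 [f [c [Pf Pc f0 ey]]]; exists (f * g), c; split => //.
- exact: subring_predM.
- exact: nzd_mulf_neq0.
- by rewrite -mulrA.
Qed.

Lemma lclosure_trans n e m e' y :
  (forall i, (i < m)%N -> lclosure n e (e' i)) -> lclosure m e' y -> lclosure n e y.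
Proof.
move=> he [f [c [Pf Pc f0 ey]]]; apply: (lclosure_div Pf f0); rewrite ey.
apply: big_ind => [||i _]; [exact: lclosure0 | exact: lclosureD |].
by apply: lclosureM => //; apply: he.
Qed.

Lemma lfree_lclosure n e y :
  lfree n e -> ~ lfree n.+1 (fun i => if i == n then y else e i) -> lclosure n e y.
Proof.
move=> he /existsNP[c /not_implyP[Pc /not_implyP[s0 h]]].
have e_lt (i : 'I_n) : (if widen_ord (leqnSn n) i == n :> nat then y
                        else e (widen_ord (leqnSn n) i)) = e i.
  by rewrite /= ltn_eqF.
move: s0; rewrite big_ord_recr /= eqxx.
under eq_bigr do rewrite e_lt.
move=> s0; exists (c n), (fun i => - c i); split => //.
- by move=> i; apply: subring_predN.
- apply/eqP => cn0; apply: h => i; rewrite ltnS leq_eqVlt => /orP[/eqP -> //|].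
  by apply: he => //; rewrite cn0 mul0r addr0 in s0.
- by move/eqP: s0; rewrite addrC addr_eq0 => /eqP ->; rewrite -sumrN;
    apply: eq_bigr => i _; rewrite mulNr.
Qed.

(** Steinitz bound: a relation between the coefficient rows, multiplied by the denominators, becomes
    a relation between the [e' i], nontrivial because there are no zero divisors. *)
Lemma lclosure_dependent n e m e' :
  (n < m)%N -> (forall i, (i < m)%N -> lclosure n e (e' i)) -> ~ lfree m e'.
Proof.
move=> nm he free.
have /choice[fc fcP] (i : 'I_m) : exists fc : R * (nat -> R),
    [/\ P fc.1, (forall j, P (fc.2 j)), fc.1 != 0
      & fc.1 * e' i = \sum_(j < n) fc.2 j * e j].
  by have [f [c ?]] := he i (ltn_ord i); exists (f, c).
have [||c [Pc [i0 ci0] cF]] := @ore_dependent 'I_m 'I_n (fun i j => (fc i).2 j).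
- by rewrite !card_ord.
- by move=> i j; case: (fcP i).
have m_gt0 : (0 < m)%N by apply: leq_ltn_trans nm.
pose c' k := if insub k is Some i then c i * (fc i).1 else 0.
have c'E (i : 'I_m) : c' i = c i * (fc i).1 by rewrite /c' valK.
have : c' i0 = 0.
  apply: free => //.
    move=> k; rewrite /c'; case: insubP => [i _ _|_]; last exact: (subring_pred0 subP).
    by case: (fcP i) => ? _ _ _; apply: subring_predM.
  transitivity (\sum_(i < m) \sum_(j < n) c i * (fc i).2 j * e j).
    apply: eq_bigr => i _; rewrite c'E -mulrA; case: (fcP i) => _ _ _ ->.
    by rewrite mulr_sumr; apply: eq_bigr => j _; rewrite mulrA.
  rewrite exchange_big big1 //= => j _.
  by rewrite -mulr_suml cF mul0r.
apply/eqP; rewrite c'E; apply: nzd_mulf_neq0 => //; by case: (fcP i0).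
Qed.

Lemma lfree_mulr n e z : z != 0 -> lfree n e -> lfree n (fun i => e i * z).
Proof.
move=> /eqP z0 he c Pc s0; apply: he => //.
have : (\sum_(i < n) c i * e i) * z = 0.
  by rewrite mulr_suml -[RHS]s0; apply: eq_bigr => i _; rewrite mulrA.
by move=> /domR[].
Qed.

Lemma lfree_neq0 n e i : lfree n e -> (i < n)%N -> e i != 0.
Proof.
move=> he i_n; apply/eqP => ei0.
have /eqP := oner_neq0 R; apply.
have := he (fun j => if j == i then 1 else 0) _ _ i i_n; rewrite eqxx; apply.
- by move=> j; case: ifP => _; [exact: subring_pred1 | exact: (subring_pred0 subP)].
- rewrite big1 // => j _; case: eqP => [->|_]; by rewrite ?ei0 ?mulr0 ?mul0r.
Qed.

End LeftOreLinearAlgebra.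

(** * Generic sequences of letters with independent partial products *)

Lemma bounded_uniq_finite (T : eqType) (B : T -> Prop) k :
  (forall s : seq T, uniq s -> (forall t, t \in s -> B t) -> (size s <= k)%N) ->
  exists s : seq T, forall t, B t -> t \in s.
Proof.
move=> bnd; apply: contrapT => /forallNP nofin.
have [s [us sB]] : exists s : seq T, [/\ uniq s, (forall t, t \in s -> B t) & size s = k.+1].
  elim: k.+1 => [|j [s [us sB ss]]]; first by exists [::].
  have /existsNP[t /not_implyP[Bt ts]] := nofin s.
  exists (t :: s); split; rewrite /= ?ss // ?us ?andbT; first exact/negP.
  by move=> x; rewrite inE => /orP[/eqP -> //|]; exact: sB.
by move=> ss; have := bnd s us sB; rewrite ss ltnn.
Qed.

Fixpoint path_node (R : nzRingType) (b : nat -> R) n : R :=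
  if n is n'.+1 then b n' * path_node b n' else 1.

Definition shift_seq (T : Type) k (b : nat -> T) i := b (k + i)%N.

Definition upd (T : Type) (b : nat -> T) k x i := if i == k then x else b i.

Lemma path_node_ext (R : nzRingType) (b b' : nat -> R) n :
  (forall i, (i < n)%N -> b i = b' i) -> path_node b n = path_node b' n.
Proof.
elim: n => //= n IH e; rewrite e // IH // => i i_n; apply: e.
exact: ltn_trans i_n _.
Qed.

Lemma path_node_shift (R : nzRingType) (b : nat -> R) k n :
  path_node (shift_seq k b) n * path_node b k = path_node b (k + n).
Proof.
elim: n => [|n IH]; first by rewrite addn0 mul1r.
by rewrite addnS /= -IH mulrA.
Qed.

Section GenericPath.
Variables (R : nzRingType) (P : R -> Prop).
Hypotheses (domR : nzd R) (subP : subring_pred P) (oreP : left_ore P).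
Variables (C : idomainType) (iota : {rmorphism C -> R}).
Hypotheses (iota_comm : forall t x, iota t * x = x * iota t).
Hypotheses (iotaP : forall t, P (iota t)) (iota_inj : forall t, t != 0 -> iota t != 0).
Hypothesis C_inf : forall s : seq C, exists t, t \notin s.

(* The relations attached to distinct bad [t] behave like eigenvectors for distinct
   eigenvalues: eliminating one [t] at a time shows that they are independent. *)
Lemma lfree_line n (Y Z : nat -> R) : lfree P n Y ->
  exists bad : seq C, forall t, t \notin bad -> lfree P n (fun i => Y i + iota t * Z i).
Proof.
move=> freeY; pose B t := ~ lfree P n (fun i => Y i + iota t * Z i).
have [bad badP] : exists s : seq C, forall t, B t -> t \in s; last first.
  by exists bad => t /negP tb; apply: contrapT => /badP.
apply: (@bounded_uniq_finite _ _ n) => s us sB.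
have /choice[c cP] (t : C) : exists c : nat -> R, t \in s ->
    [/\ forall i, P (c i), \sum_(i < n) c i * (Y i + iota t * Z i) = 0
      & exists i : 'I_n, c i != 0].
  have [ts|_] := boolP (t \in s); last by exists (fun=> 0).
  have /existsNP[c /not_implyP[Pc /not_implyP[s0 h]]] := sB _ ts.
  exists c => _; split => //; apply: contrapT => h'; apply: h => i i_n.
  by apply/eqP/negP => /negP ci; apply: h'; exists (Ordinal i_n).
have s_neq0 t : t \in s -> t != 0.
  move=> ts; apply/eqP => t0; apply: (sB _ ts); apply: lfree_ext freeY => i _.
  by rewrite t0 rmorph0 mul0r addr0.
pose z t := \sum_(j < n) c t j * Z j.
have cY t : t \in s -> \sum_(j < n) c t j * Y j = - (iota t * z t).
  move=> ts; have [_ + _] := cP _ ts.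
  under eq_bigr do rewrite mulrDr.
  rewrite big_split /= => /eqP; rewrite addr_eq0 => /eqP ->; congr (- _).
  by rewrite mulr_sumr; apply: eq_bigr => j _; rewrite !mulrA iota_comm.
rewrite leqNgt; apply/negP => ns.
(* The relations [c t] have [n] entries and there are more than [n] of them, so [ore_dependent]
   makes them dependent; it suffices to show that they are independent. *)
suff ind (r : seq C) (a : C -> R) : uniq r -> {subset r <= s} -> (forall t, P (a t)) ->
    (forall j : 'I_n, \sum_(t <- r) a t * c t j = 0) -> forall t, t \in r -> a t = 0.
  have [||al [Pa [i0 ai0] aF]] := @ore_dependent R P domR subP oreP 'I_(size s) 'I_n
    (fun i j => c s`_i j).
  - by rewrite !card_ord.
  - by move=> i j; case: (cP _ (mem_nth 0 (ltn_ord i))).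
  pose a t := if insub (index t s) is Some i then al i else 0.
  have aE (i : 'I_(size s)) : a s`_i = al i by rewrite /a index_uniq // valK.
  move/eqP: ai0; apply; rewrite -aE.
  apply: (ind s) => //; last exact: mem_nth.
    by move=> t; rewrite /a; case: insubP => *; rewrite ?Pa //; exact: (subring_pred0 subP).
  move=> j; rewrite -[RHS](aF j) (big_nth 0) big_mkord.
  by apply: eq_bigr => i _; rewrite aE.
elim: r a => // r s' IH a /= /andP[rs' us'] sub Pa aF.
have subs' : {subset s' <= s} by move=> t ts'; apply: sub; rewrite inE ts' orbT.
have rs : r \in s by apply: sub; rewrite inE eqxx.
(* The factor [t - r] in [a'] removes the term of [r]. The factor [u t] completes the scalar [t] of
   the relation [cY] to the product over all of [s'], which is the same for every term and can be
   pulled out of the sum. *)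
pose u t := \prod_(x <- s' | x != t) x.
pose a' t := a t * iota ((t - r) * u t).
have a'0 t : t \in s' -> a' t = 0.
  apply: IH => // [x|j]; first exact: subring_predM.
  have h0 : \sum_(x <- r :: s') a x * z x = 0.
    under eq_bigr do rewrite mulr_sumr.
    rewrite exchange_big big1 //= => i _; under eq_bigr do rewrite mulrA.
    by rewrite -mulr_suml aF mul0r.
  have h1 : \sum_(x <- r :: s') a x * (iota x * z x) = 0.
    apply/eqP; rewrite -oppr_eq0 -sumrN big_seq.
    under eq_bigr => x xs do rewrite -mulrN -cY ?sub // mulr_sumr.
    rewrite -big_seq exchange_big big1 //= => i _; under eq_bigr do rewrite mulrA.
    by rewrite -mulr_suml aF mul0r.
  have h2 : \sum_(x <- s') a x * (iota (x - r) * z x) = 0.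
    have : \sum_(x <- r :: s') a x * (iota (x - r) * z x) = 0.
      under eq_bigr do rewrite rmorphB mulrBl mulrBr.
      rewrite sumrB h1 sub0r; apply/eqP; rewrite oppr_eq0; apply/eqP.
      transitivity (iota r * \sum_(x <- r :: s') a x * z x); last by rewrite h0 mulr0.
      rewrite mulr_sumr; apply: eq_bigr => x _.
      by rewrite !mulrA iota_comm.
    by rewrite big_cons subrr rmorph0 mul0r mulr0 add0r.
  have h3 : \sum_(i < n) (\sum_(x <- s') a' x * c x i) * Y i = 0.
    transitivity (\sum_(x <- s') a' x * \sum_(i < n) c x i * Y i).
      under eq_bigr do rewrite mulr_suml.
      rewrite exchange_big /=; apply: eq_bigr => x _; rewrite mulr_sumr.
      by apply: eq_bigr => i _; rewrite mulrA.
    rewrite big_seq; under eq_bigr => x xs' do rewrite cY ?subs' // mulrN.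
    rewrite sumrN; apply/eqP; rewrite oppr_eq0 -big_seq; apply/eqP.
    transitivity (iota (\prod_(x <- s') x) * \sum_(x <- s') a x * (iota (x - r) * z x));
      last by rewrite h2 mulr0.
    rewrite mulr_sumr.
    rewrite big_seq [RHS]big_seq; apply: eq_bigr => x xs'.
    rewrite (bigD1_seq x) //= -/(u x) /a' -!mulrA !mulrA iota_comm -!mulrA; congr (_ * _).
    by rewrite !mulrA -!rmorphM; congr (iota _ * _); rewrite mulrAC [RHS]mulrC mulrA.
  have := freeY (fun i => \sum_(x <- s') a' x * c x i) _ h3 j (ltn_ord j); apply.
  move=> i; rewrite big_seq; apply: subring_pred_sum => // x xs'.
  by case: (cP _ (subs' _ xs')) => Pc _ _; apply: subring_predM => //; apply: subring_predM.
have as' t : t \in s' -> a t = 0.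
  move=> ts'; have /domR[//|/eqP] := a'0 _ ts'.
  rewrite (negPf (iota_inj _)) // mulf_neq0 //.
    by rewrite subr_eq0; apply: contraNneq rs' => <-.
  by rewrite /u prodf_seq_neq0; apply/allP => x xs'; rewrite s_neq0 ?implybT // subs'.
move=> t; rewrite inE => /orP[/eqP ->|]; last exact: as'.
have [_ _ [i ci]] := cP _ rs.
have := aF i; rewrite big_cons big_seq big1 ?addr0; last by move=> x xs'; rewrite as' // mul0r.
by move=> /domR[//|/eqP]; rewrite (negPf ci).
Qed.

(** A path product is affine in each letter, because the letter occurs at most once and [iota t] is
    central. *)
Lemma path_node_upd_line (b : nat -> R) k t x n :
  path_node (upd b k (b k + iota t * x)) n =
    path_node b n + iota t * (if (k < n)%N then path_node (upd b k x) n else 0).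
Proof.
elim: n => [|n IH] /=; first by rewrite mulr0 addr0.
rewrite IH ltnS /upd; have [->|nk] := eqVneq n k.
  rewrite ltnn leqnn mulr0 addr0 mulrDl -mulrA.
  congr (_ + _ * (_ * _)); apply: path_node_ext => i i_n.
  by rewrite ltn_eqF.
have -> : (k <= n)%N = (k < n)%N by rewrite ltn_neqAle eq_sym nk.
by case: ltnP => _ /=; rewrite ?mulr0 ?addr0 // mulrDr !mulrA iota_comm.
Qed.

(** A substitute for Zariski openness: it is tested only along lines that move a single letter, with
    finitely many exceptional parameters. *)
Definition line_open (O : (nat -> R) -> Prop) : Prop :=
  forall b k x, O b ->
    exists bad : seq C, forall t, t \notin bad -> O (upd b k (b k + iota t * x)).

Definition depends_below m (O : (nat -> R) -> Prop) : Prop :=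
  forall b b', (forall i, (i < m)%N -> b i = b' i) -> O b -> O b'.

Variable L : R -> Prop.
Hypotheses (L1 : L 1) (LD : forall x y, L x -> L y -> L (x + y)).
Hypothesis LZ : forall t x, L x -> L (iota t * x).

Lemma letterB x y : L x -> L y -> L (x - y).
Proof.
move=> Lx Ly; apply: LD => //; rewrite -mulN1r -(rmorph1 iota) -rmorphN.
exact: LZ.
Qed.

Lemma letter_upd (b : nat -> R) k x : (forall i, L (b i)) -> L x -> forall i, L (upd b k x i).
Proof. by move=> Lb Lx i; rewrite /upd; case: ifP. Qed.

(** Two nonempty open sets meet: one coordinate at a time, the two points are moved to a common
    point of the line joining their letters. Finitely many coordinates suffice because [O2] depends
    only on the first [m]. *)
Lemma line_open_meet m (O1 O2 : (nat -> R) -> Prop) b c :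
  line_open O1 -> line_open O2 -> depends_below m O2 ->
  (forall i, L (b i)) -> (forall i, L (c i)) -> O1 b -> O2 c ->
  exists d, [/\ forall i, L (d i), O1 d & O2 d].
Proof.
move=> op1 op2 loc2 Lb Lc Ob Oc.
suff [b' [c' [Lb' _ Ob' Oc' e]]] : exists b' c', [/\ forall i, L (b' i),
    forall i, L (c' i), O1 b', O2 c' & forall i, (i < m)%N -> b' i = c' i].
  by exists b'; split => //; apply: loc2 Oc' => i im; rewrite e.
elim: m {loc2} => [|k [b' [c' [Lb' Lc' Ob' Oc' e]]]]; first by exists b, c.
have [bad1 bad1P] := op1 _ k (c' k - b' k) Ob'.
have [bad2 bad2P] := op2 _ k (b' k - c' k) Oc'.
(* The same point has parameter [t] seen from [b'] and [1 - t] seen from [c'], so [t] must avoid the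
   reflected exceptions of the second line. *)
have [t] := C_inf (bad1 ++ [seq 1 - x | x <- bad2]).
rewrite mem_cat negb_or => /andP[t1 t2].
have t2' : 1 - t \notin bad2.
  by apply: contra t2 => t2; apply/mapP; exists (1 - t); rewrite // opprB addrC subrK.
exists (upd b' k (b' k + iota t * (c' k - b' k))),
       (upd c' k (c' k + iota (1 - t) * (b' k - c' k))); split.
- by apply: letter_upd => //; apply: LD => //; apply: LZ; apply: letterB.
- by apply: letter_upd => //; apply: LD => //; apply: LZ; apply: letterB.
- exact: bad1P.
- exact: bad2P.
- move=> i; rewrite ltnS /upd; case: eqP => [_ _|/eqP ik]; last first.
    by rewrite leq_eqVlt (negPf ik); exact: e.
  by rewrite rmorphB rmorph1 mulrBl mul1r -mulrN opprB addrA subrKC.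
Qed.

Definition free_path n (b : nat -> R) : Prop := lfree P n.+1 (path_node b).

(** Freeness is asked at every starting point up to [m], so that a path that cannot be prolonged
    yields a recurrence for all of its later nodes. *)
Definition free_windows n m (b : nat -> R) : Prop :=
  forall q, (q <= m)%N -> free_path n (shift_seq q b).

Lemma shift_upd (b : nat -> R) q k x i :
  shift_seq q (upd b k x) i =
    if (q <= k)%N then upd (shift_seq q b) (k - q)%N x i else shift_seq q b i.
Proof.
rewrite /shift_seq /upd; case: leqP => [qk|kq].
  by congr (if _ then _ else _); rewrite -{1}(subnKC qk) eqn_add2l.
by rewrite gtn_eqF // (leq_trans kq) // leq_addr.
Qed.

(** By [path_node_upd_line] the nodes move as [Y i + iota t * Z i], the situation of [lfree_line]; a
    letter before the window does not affect it. *)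
Lemma line_open_window n q : line_open (fun b => free_path n (shift_seq q b)).
Proof.
move=> b k x fb; have [qk|kq] := leqP q k; last first.
  exists [::] => t _; apply: lfree_ext fb => i _; apply: path_node_ext => j _.
  by rewrite shift_upd leqNgt kq.
have [bad badP] := lfree_line
  (fun i => if (k - q < i)%N then path_node (upd (shift_seq q b) (k - q)%N x) i else 0) fb.
exists bad => t /badP; apply: lfree_ext => i _.
rewrite -path_node_upd_line; apply: path_node_ext => j _.
by rewrite shift_upd qk /shift_seq subnKC.
Qed.

Lemma window_depends_below n q :
  depends_below (q + n) (fun b => free_path n (shift_seq q b)).
Proof.
move=> b b' e; apply: lfree_ext => i i_n; apply: path_node_ext => j ji.
by rewrite /shift_seq e // ltn_add2l (leq_trans ji).
Qed.

Lemma line_open_windows n m : line_open (free_windows n m).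
Proof.
move=> b k x; elim: m => [|m IH] fb.
  have [bad badP] := line_open_window k x (fb 0 isT).
  by exists bad => t tb q; rewrite leqn0 => /eqP ->; apply: badP.
have [q qm|bad1 bad1P] := IH; first by apply: fb; exact: leqW.
have [bad2 bad2P] := line_open_window k x (fb m.+1 (leqnn _)).
exists (bad1 ++ bad2) => t; rewrite mem_cat negb_or => /andP[t1 t2] q.
by rewrite leq_eqVlt => /orP[/eqP ->|]; [exact: bad2P | exact: bad1P].
Qed.

Lemma free_windows_exist n m c : (forall i, L (c i)) -> free_path n c ->
  exists b, (forall i, L (b i)) /\ free_windows n m b.
Proof.
move=> Lc fc; elim: m => [|m [b [Lb wb]]].
  exists c; split => // q; rewrite leqn0 => /eqP ->.
  exact: fc.
(* Delaying [c] by [m.+1] makes the window at [m.+1] a copy of the free path [c]; by truncated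
   subtraction the earlier letters are all [c 0]. *)
pose c' i := c (i - m.+1)%N.
have fc' : free_path n (shift_seq m.+1 c').
  apply: lfree_ext fc => i _; apply: path_node_ext => j _.
  by rewrite /shift_seq /c' addKn.
have [d [Ld wd fd]] := line_open_meet (line_open_windows (n := n) (m := m))
  (@line_open_window n m.+1) (@window_depends_below n m.+1) Lb (fun i => Lc _) wb fc'.
exists d; split => // q; rewrite leq_eqVlt => /orP[/eqP -> //|]; exact: wd.
Qed.

(** Words grow on the right, where they meet the path product that they multiply; path products
    themselves grow on the left. *)
Inductive word_sum : nat -> R -> Prop :=
| word_sum1 : word_sum 0 1
| word_sumM j x l : word_sum j x -> L l -> word_sum j.+1 (x * l)
| word_sumD j x y : word_sum j x -> word_sum j y -> word_sum j (x + y).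

Lemma word_sumW i j x : (i <= j)%N -> word_sum i x -> word_sum j x.
Proof.
move=> /subnKC <-; elim: (j - i)%N => [|k IH]; rewrite ?addn0 // => /IH h.
by rewrite addnS -(mulr1 x); apply: word_sumM.
Qed.

(* Perturbing one letter of a path by [iota t * l] keeps its windows free; the
   difference of the two paths is [iota t] times the path through the letter [l]. *)
Lemma word_mul_lclosure n j b :
  (forall i, L (b i)) -> (forall c, (forall i, L (c i)) -> ~ free_path n.+1 c) ->
  free_windows n j b ->
  forall i, (i <= j)%N -> forall x, word_sum i x ->
    lclosure P n.+1 (path_node b) (x * path_node b (n + (j - i))%N).
Proof.
move=> + noext; move=> Lb wb i; elim: i b Lb wb => [|i IH] b Lb wb ij x wx.
  (* Base case: the free window at [m - n.+1] cannot be prolonged, so node [m] depends on the [n.+1]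
     nodes before it, and strong induction brings it down to the first ones. *)
  suff h m : (m <= n.+1 + j)%N -> lclosure P n.+1 (path_node b) (path_node b m).
    have {}h : lclosure P n.+1 (path_node b) (path_node b (n + j)).
      by apply: h; rewrite leq_add2r.
    rewrite subn0; move: wx; move: {1 3}0%N (erefl 0%N) => z ez wx.
    elim: wx ez => // [_|k y y' _ ih _ ih' ez]; first by rewrite mul1r.
    by rewrite mulrDl; apply: lclosureD => //; [exact: ih | exact: ih'].
  elim/ltn_ind: m => m IHm mj.
  have [mn|nm] := ltnP m n.+1; first exact: lclosure_gen.
  pose q := (m - n.+1)%N; have qj : (q <= j)%N by rewrite /q leq_subLR.
  have fq := wb q qj.
  have mE : m = (q + n.+1)%N by rewrite /q subnK.
  have : lclosure P n.+1 (path_node (shift_seq q b)) (path_node (shift_seq q b) n.+1).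
    apply: lfree_lclosure => // h.
    apply: (noext (shift_seq q b)); first by move=> ?; exact: Lb.
    apply: lfree_ext h => k; rewrite ltnS leq_eqVlt.
    by case: eqP => [->|_ //].
  move=> [f [c [Pf Pc f0 e]]].
  apply: (@lclosure_trans _ _ domR subP oreP _ _ n.+1 (fun k => path_node b (q + k))).
    move=> k kn; apply: IHm; first by rewrite mE ltn_add2l.
    by apply: leq_trans mj; rewrite mE leq_add2l ltnW.
  exists f, c; split => //.
  rewrite mE -path_node_shift mulrA e mulr_suml; apply: eq_bigr => k _.
  by rewrite -mulrA path_node_shift.
move: wx; move: {1 3}i.+1 (erefl i.+1) => z ez wx.
elim: wx ez => // [k y l wy _ Ll [ki]|k y y' _ ih _ ih' ez]; last first.
  by rewrite mulrDl; apply: lclosureD => //; [exact: ih | exact: ih'].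
subst k; set p := (n + (j - i.+1))%N.
have pE : (n + (j - i))%N = p.+1 by rewrite /p -addnS -subSn // subSS.
(* Since [p >= n], letter [p] enters none of the nodes [0, ..., n], so the perturbed path has the
   same closure. Subtracting the two memberships leaves [y * l * path_node b p] up to the factor
   [iota t], whence [t != 0]. *)
have [bad badP] := line_open_windows p l wb.
have [t] := C_inf (0 :: bad); rewrite inE negb_or => /andP[t0 tbad].
have h1 := IH b Lb wb (ltnW ij) y wy.
have := IH _ (letter_upd p Lb (LD (Lb p) (LZ t Ll))) (badP t tbad) (ltnW ij) y wy.
rewrite pE in h1 *; move/lclosure_ext => /(_ (path_node b)) [] => [m mn|].
  apply: path_node_ext => k km; rewrite /upd ltn_eqF // (leq_trans km) //.
  by rewrite (leq_trans _ (leq_addr _ _)).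
move=> f [c [Pf Pc f0 e]].
have h2 : lclosure P n.+1 (path_node b)
    (y * path_node (upd b p (b p + iota t * l)) p.+1) by exists f, c; split.
apply: (@lclosure_div _ _ domR subP _ _ (iota t)) => //; first exact: iota_inj.
have := lclosureB domR subP oreP h2 h1.
rewrite path_node_upd_line leqnn mulrDr addrC addKr /= {1}/upd eqxx.
rewrite (path_node_ext (b := upd b p l) (b' := b)); last by move=> k kp; rewrite /upd ltn_eqF.
by rewrite !mulrA iota_comm.
Qed.

(** If no free path of length [n] could be prolonged, all word sums of some length [j], multiplied
    by a nonzero node, would lie in the closure of [n.+1] nodes; but [n.+2] of them are
    independent. *)
Lemma generic_path_free n :
  (forall r, exists j (g : nat -> R), lfree P r g /\ forall i, (i < r)%N -> word_sum j (g i)) ->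
  exists b, (forall i, L (b i)) /\ free_path n b.
Proof.
move=> inf; elim: n => [|n [c [Lc fc]]].
  exists (fun=> 1); split => // c Pc; rewrite big_ord1 mulr1 => c0 i.
  by rewrite ltnS leqn0 => /eqP ->.
apply: contrapT => /forallNP noext'.
have noext d : (forall i, L (d i)) -> ~ free_path n.+1 d.
  by move=> Ld fd; apply: (noext' d).
have [j [g [fg wg]]] := inf n.+2.
have [b [Lb wb]] := free_windows_exist j Lc fc.
have z0 : path_node b n != 0.
  exact: (lfree_neq0 subP (wb 0%N isT) (ltnSn n)).
apply: (@lclosure_dependent _ _ domR subP oreP n.+1 (path_node b) n.+2
  (fun i => g i * path_node b n)) => //; last exact: lfree_mulr.
move=> i i_n; have := word_mul_lclosure Lb noext wb (leqnn j) (wg i i_n).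
by rewrite subnn addn0.
Qed.

End GenericPath.

(** * Polynomials over a division ring and left spans over a division subalgebra *)

Section PolynomialScalars.
Variables (K : fieldType) (D : unitAlgType K).
Hypothesis divD : is_division_ring D.

Lemma division_nzd : nzd D.
Proof.
move=> x y xy; have [->|x0] := eqVneq x 0; first by left.
by right; rewrite -(mulKr (divD x0) y) xy mulr0.
Qed.

Lemma poly_nzd : nzd {poly D}.
Proof.
move=> p q pq; have [->|p0] := eqVneq p 0; first by left.
have [->|q0] := eqVneq q 0; first by right.
have /size_proper_mul : lead_coef p * lead_coef q != 0.
  by apply: (nzd_mulf_neq0 division_nzd); rewrite lead_coef_eq0.
move: p0 q0; rewrite pq size_poly0 -!size_poly_gt0.
by case: (size p) => // a _; case: (size q) => // b _; rewrite addnS.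
Qed.

Definition coefs_in (E : D -> Prop) (p : {poly D}) : Prop := forall i, E p`_i.

Section DivSubalg.
Variable E : D -> Prop.
Hypothesis subE : is_divsubalg E.

Lemma divsubalg_scalar k : E k%:A. Proof. by case: subE. Qed.
Lemma divsubalgV x : E x -> x != 0 -> E x^-1.
Proof. by case: subE => _ [_ [_ [_ h]]]; apply: h. Qed.

Lemma divsubalg_subring : subring_pred E.
Proof.
case: subE => hk [hD [hN [hM _]]]; split => // [|x y Ex Ey].
  by rewrite -(scale1r 1); apply: hk.
by apply: hD => //; apply: hN.
Qed.

Lemma divsubalg_ore : left_ore E.
Proof.
move=> x y Ex Ey y0; exists 1, (x * y^-1); split.
- exact: (subring_pred1 divsubalg_subring).
- by apply: (subring_predM divsubalg_subring) => //; apply: divsubalgV.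
- exact: oner_neq0.
- by rewrite mul1r mulrVK // divD.
Qed.

Lemma coefs_in_subring : subring_pred (coefs_in E).
Proof.
split => [i|p q Ep Eq i|p q Ep Eq i].
- rewrite coef1; case: eqP => _; first exact: (subring_pred1 divsubalg_subring).
  exact: (subring_pred0 divsubalg_subring).
- by rewrite coefB; apply: (subring_predB divsubalg_subring).
- rewrite coefM; apply: (subring_pred_sum divsubalg_subring) => j _.
  exact: (subring_predM divsubalg_subring).
Qed.

Lemma coefs_inC x : E x -> coefs_in E x%:P.
Proof.
by move=> Ex i; rewrite coefC; case: eqP => _ //; exact: (subring_pred0 divsubalg_subring).
Qed.

Lemma coefs_inXn n : coefs_in E 'X^n.
Proof.
move=> i; rewrite coefXn; case: eqP => _; first exact: (subring_pred1 divsubalg_subring).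
exact: (subring_pred0 divsubalg_subring).
Qed.

Lemma coefs_in_reduce (f g : {poly D}) : coefs_in E f -> coefs_in E g -> g != 0 ->
  f != 0 -> (size g <= size f)%N ->
  exists m, coefs_in E m /\ (size (f - m * g)%R < size f)%N.
Proof.
move=> Ef Eg g0 f0 gf.
pose c := lead_coef f * (lead_coef g)^-1.
pose m : {poly D} := c%:P * 'X^(size f - size g).
exists m; split.
  apply: (subring_predM coefs_in_subring); last exact: coefs_inXn.
  apply: coefs_inC; apply: (subring_predM divsubalg_subring); first exact: Ef.
  by apply: divsubalgV; rewrite ?lead_coef_eq0 //; exact: Eg.
have sg : (0 < size g)%N by rewrite size_poly_gt0.
have sf : (0 < size f)%N by rewrite size_poly_gt0.
have mE : m * g = c%:P * g * 'X^(size f - size g).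
  by rewrite /m -!mulrA -commr_polyXn.
rewrite -(prednK sf) ltnS; apply/leq_sizeP => j.
rewrite coefB mE coefMXn coefCM leq_eqVlt => /orP[/eqP <-|fj].
  have -> : ((size f).-1 < size f - size g)%N = false.
    apply/negbTE; rewrite -leqNgt -subn1; exact: leq_sub2l.
  have -> : ((size f).-1 - (size f - size g) = (size g).-1)%N.
    move: gf sg; case: (size g) => // b; case: (size f) => // a ab _ /=.
    by rewrite subSS subKn.
  by rewrite /c mulrVK ?subrr // divD // lead_coef_eq0.
rewrite prednK // in fj; rewrite nth_default // sub0r.
have -> : (j < size f - size g)%N = false.
  by apply/negbTE; rewrite -leqNgt (leq_trans _ fj) // leq_subr.
rewrite [g`_ _]nth_default ?mulr0 ?oppr0 //.
by rewrite leq_subRL ?(leq_trans _ fj) ?leq_subr // subnK.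
Qed.

(** Euclidean algorithm on the sum of the sizes. When [g] is the one reduced, the roles are
    exchanged and the multiplier of [f] is nonzero because [b * g] is. *)
Lemma coefs_in_ore : left_ore (coefs_in E).
Proof.
have sub := coefs_in_subring.
move=> f g; have [n] := ubnP (size f + size g).
elim: n f g => // n IH f g fgn Ef Eg g0.
have [->|f0] := eqVneq f 0.
  exists 1, 0; split; [exact: (subring_pred1 sub) | exact: (subring_pred0 sub)
      | exact: oner_neq0 | by rewrite mulr0 mul0r].
have [fg|gf] := ltnP (size f) (size g).
  have [m [Em sm]] := coefs_in_reduce Eg Ef f0 g0 (ltnW fg).
  have [||b [a [Eb Ea b0 e]]] := IH (g - m * f) f _ _ Ef f0.
  - by rewrite -ltnS (leq_trans _ fgn) // ltnS addnC ltn_add2l.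
  - by apply: (subring_predB sub) => //; apply: (subring_predM sub).
  exists (a + b * m), b.
  have eq : (a + b * m) * f = b * g by rewrite mulrDl -e mulrBr mulrA subrK.
  split => //; first by apply: (subring_predD sub) => //; apply: (subring_predM sub).
  apply: contraTneq (nzd_mulf_neq0 poly_nzd b0 g0) => ab0.
  by rewrite -eq ab0 mul0r eqxx.
have [m [Em sm]] := coefs_in_reduce Ef Eg g0 f0 gf.
have [||a [b [Ea Eb a0 e]]] := IH (f - m * g) g _ _ Eg g0.
- by rewrite -ltnS (leq_trans _ fgn) // ltnS ltn_add2r.
- by apply: (subring_predB sub) => //; apply: (subring_predM sub).
exists a, (b + a * m); split => //.
  by apply: (subring_predD sub) => //; apply: (subring_predM sub).
by rewrite mulrDl -e mulrBr mulrA subrK.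
Qed.

Lemma coefs_in_scalar (t : {poly K}) : coefs_in E (map_poly (in_alg D) t).
Proof. by move=> i; rewrite coef_map; apply: divsubalg_scalar. Qed.

Lemma divsubalgZ k x : E x -> E (k *: x).
Proof.
move=> Ex; rewrite -mulr_algl; apply: (subring_predM divsubalg_subring) => //.
exact: divsubalg_scalar.
Qed.

Lemma lfree_polyC n (h : nat -> D) :
  lfree E n h -> lfree (coefs_in E) n (fun i => (h i)%:P).
Proof.
move=> fh c Ec s0 i i_n; apply/polyP => k; rewrite coef0.
apply: (fh (fun i => (c i)`_k)) => // [j|]; first exact: Ec.
transitivity ((\sum_(i < n) c i * (h i)%:P)`_k); last by rewrite s0 coef0.
by rewrite coef_sum; apply: eq_bigr => j _; rewrite coefMC.
Qed.

Definition fspan n (h : nat -> D) (y : D) : Prop :=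
  exists c : nat -> D, (forall i, E (c i)) /\ y = \sum_(i < n) c i * h i.

(** Independence in the form in which a greedy choice produces it, one vector at a time. *)
Definition triangular n (h : nat -> D) : Prop :=
  forall i, (i < n)%N -> ~ fspan i h (h i).

Lemma fspan_gen n h i : (i < n)%N -> fspan n h (h i).
Proof.
move=> i_n; exists (fun j => if j == i then 1 else 0); split.
  move=> j; case: ifP => _; first exact: (subring_pred1 divsubalg_subring).
  exact: (subring_pred0 divsubalg_subring).
rewrite (bigD1 (Ordinal i_n)) //= eqxx mul1r big1 ?addr0 // => j.
by rewrite -val_eqE /= => /negPf ->; rewrite mul0r.
Qed.

Lemma fspan0 n h : fspan n h 0.
Proof.
exists (fun=> 0); split; first by move=> _; exact: (subring_pred0 divsubalg_subring).
by rewrite big1 // => i _; rewrite mul0r.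
Qed.

Lemma fspanD n h x y : fspan n h x -> fspan n h y -> fspan n h (x + y).
Proof.
move=> [c [Ec ->]] [d [Ed ->]]; exists (fun i => c i + d i); split.
  by move=> i; apply: (subring_predD divsubalg_subring).
by rewrite -big_split; apply: eq_bigr => i _; rewrite mulrDl.
Qed.

Lemma fspanM n h a x : E a -> fspan n h x -> fspan n h (a * x).
Proof.
move=> Ea [c [Ec ->]]; exists (fun i => a * c i); split.
  by move=> i; apply: (subring_predM divsubalg_subring).
by rewrite mulr_sumr; apply: eq_bigr => i _; rewrite mulrA.
Qed.

Lemma fspan_sum n h (I : Type) (r : seq I) (Q : pred I) (F : I -> D) :
  (forall i, Q i -> fspan n h (F i)) -> fspan n h (\sum_(i <- r | Q i) F i).
Proof. by move=> hF; apply: big_ind => //; [exact: fspan0 | exact: fspanD]. Qed.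

Lemma fspan_ext n h h' y :
  (forall i, (i < n)%N -> h i = h' i) -> fspan n h y -> fspan n h' y.
Proof.
move=> e [c [Ec ->]]; exists c; split => //.
by apply: eq_bigr => i _; rewrite e.
Qed.

Lemma triangular_lfree n h : triangular n h -> lfree E n h.
Proof.
elim: n => [//|n IH] th c Ec; rewrite big_ord_recr /= => s0.
have cn : c n = 0.
  apply: contrapT => /eqP cn; apply: (th n (ltnSn n)).
  exists (fun i => - ((c n)^-1 * c i)); split.
    move=> i; apply: (subring_predN divsubalg_subring).
    by apply: (subring_predM divsubalg_subring) => //; apply: divsubalgV.
  apply: (mulrI (divD cn)); apply/eqP; rewrite -subr_eq0 -[X in _ == X]s0.
  rewrite addrC; apply/eqP; congr (_ + _).
  rewrite mulr_sumr -sumrN; apply: eq_bigr => i _.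
  by rewrite mulNr mulrN opprK -mulrA mulVKr // divD.
move=> i; rewrite ltnS leq_eqVlt => /orP[/eqP -> //|].
apply: IH => // [j jn|]; first by apply: th; exact: ltnW.
by rewrite cn mul0r addr0 in s0.
Qed.

Lemma fspan_dependent n h m h' :
  (n < m)%N -> (forall i, (i < m)%N -> fspan n h (h' i)) -> ~ lfree E m h'.
Proof.
move=> nm sp; apply: (lclosure_dependent division_nzd divsubalg_subring divsubalg_ore nm).
move=> i im; have [c [Ec e]] := sp i im; exists 1, c; split => //.
- exact: (subring_pred1 divsubalg_subring).
- exact: oner_neq0.
- by rewrite mul1r e.
Qed.

Lemma triangular_snoc n h y : triangular n h -> ~ fspan n h y ->
  triangular n.+1 (upd h n y).
Proof.
have e i : (i <= n)%N -> forall j, (j < i)%N -> upd h n y j = h j.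
  by move=> i_n j ji; rewrite /upd ltn_eqF // (leq_trans ji).
move=> th hy i; rewrite ltnS leq_eqVlt => /orP[/eqP ->|i_n].
  rewrite {2}/upd eqxx => /(fspan_ext (e n (leqnn n))); exact: hy.
rewrite {2}/upd ltn_eqF // => /(fspan_ext (e i (ltnW i_n))); exact: th.
Qed.

Lemma infinite_triangular (E' : D -> Prop) : ~ left_findim E E' ->
  forall n, exists h, triangular n h /\ forall i, (i < n)%N -> E' (h i).
Proof.
move=> inf; elim=> [|n [h [th Eh]]]; first by exists (fun=> 0).
have [y [Ey hy]] : exists y, E' y /\ ~ fspan n h y.
  apply: contrapT => /forallNP no; apply: inf.
  exists (mkseq h n); rewrite size_mkseq; split => [j jn|y Ey].
    by rewrite nth_mkseq //; exact: Eh.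
  have [c [Ec ->]] : fspan n h y by apply: contrapT => hy; apply: (no y).
  exists (mkseq c n); rewrite size_mkseq; split=> //; split.
    by move=> j jn; rewrite nth_mkseq.
  by apply: eq_bigr => i _; rewrite !nth_mkseq.
exists (upd h n y); split; first exact: triangular_snoc.
move=> i; rewrite ltnS leq_eqVlt /upd; case: eqP => //= _; exact: Eh.
Qed.

(* Right multiplication by [d] is an injective endomorphism of a left vector
   space of finite dimension, hence onto; concretely a linear relation between
   the [x * d ^+ i], divided by its lowest power of [d], expresses [x / d]. *)
Lemma fspan_stableV n h d : d != 0 -> (forall x, fspan n h x -> fspan n h (x * d)) ->
  forall x, fspan n h x -> fspan n h (x * d^-1).
Proof.
move=> d0 st x hx.
have hxd i : fspan n h (x * d ^+ i).
  by elim: i => [|i IH]; rewrite ?mulr1 // exprSr mulrA; apply: st.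
have := @fspan_dependent n h n.+1 (fun i => x * d ^+ i) (ltnSn n) (fun i _ => hxd i).
move=> /existsNP[c /not_implyP[Ec /not_implyP[s0 nz]]].
have ex : exists i, (i < n.+1)%N && (c i != 0).
  apply: contrapT => no; apply: nz => i i_n.
  by apply/eqP/negP => /negP ci; apply: no; exists i; rewrite i_n.
case: (ex_minnP ex) => k /andP[kn ck] kmin.
suff : fspan n h (c k * (x * d^-1)).
  move=> /(fspanM (divsubalgV (Ec k) ck)); by rewrite mulKr // divD.
have dk : d ^+ k.+1 \is a GRing.unit by rewrite unitrX // divD.
have -> : c k * (x * d^-1) = - \sum_(i < n.+1 | (k < i)%N) c i * (x * d ^+ (i - k.+1)).
  apply: (mulIr dk); rewrite mulNr mulr_suml.
  transitivity (- \sum_(i < n.+1 | (k < i)%N) c i * (x * d ^+ i)); last first.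
    by congr (- _); apply: eq_bigr => i ki; rewrite -!mulrA -exprD subnK.
  move: s0; rewrite (bigID (fun i : 'I_n.+1 => (k < i)%N)) /= => /eqP.
  rewrite addrC addr_eq0 => /eqP <-.
  rewrite (bigD1 (Ordinal kn)) /= ?ltnn // big1 ?addr0.
    by rewrite exprS -!mulrA mulKr // divD.
  move=> i /andP[]; rewrite -leqNgt leq_eqVlt -val_eqE /= => /orP[/eqP ->|ik]; rewrite ?eqxx //.
  move=> _; have [->|ci] := eqVneq (c i) 0; first by rewrite mul0r.
  by have := kmin i; rewrite ltn_ord ci => /(_ isT); rewrite leqNgt ik.
rewrite -mulN1r; apply: fspanM.
  by apply: (subring_predN divsubalg_subring); exact: (subring_pred1 divsubalg_subring).
by apply: fspan_sum => i _; apply: fspanM.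
Qed.

(** Lets stability of a span under right multiplication pass from generators to the whole division
    algebra that they generate. *)
Lemma fspan_stabilizer_divsubalg n h :
  is_divsubalg (fun d => forall x, fspan n h x -> fspan n h (x * d)).
Proof.
split=> [k x hx|]; first by rewrite mulr_algr -mulr_algl; apply: fspanM => //; exact: divsubalg_scalar.
split=> [a b ha hb x hx|]; first by rewrite mulrDr; apply: fspanD; [apply: ha | apply: hb].
split=> [a ha x hx|].
  rewrite mulrN -mulN1r; apply: fspanM; last exact: ha.
  by apply: (subring_predN divsubalg_subring); exact: (subring_pred1 divsubalg_subring).
split=> [a b ha hb x hx|a ha a0]; first by rewrite mulrA; apply: hb; apply: ha.
exact: fspan_stableV.
Qed.

(** Each word length contributes a new vector: were all words of length [n], times [z], in the span
    of [h], this span would be stable under the letters, hence under [E'], and would contain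
    [z * E']. *)
Lemma words_triangular (L E' : D -> Prop) z : z != 0 -> L 1 ->
  (forall T, is_divsubalg T -> (forall x, L x -> T x) -> forall x, E' x -> T x) ->
  (forall n h, ~ forall y, E' y -> fspan n h (z * y)) ->
  forall n, exists h, triangular n h /\
    forall i, (i < n)%N -> exists x, word_sum L i x /\ h i = z * x.
Proof.
move=> z0 L1 gen inf; elim=> [|n [h [th hw]]]; first by exists (fun=> 0).
have [x [wx hx]] : exists x, word_sum L n x /\ ~ fspan n h (z * x).
  apply: contrapT => /forallNP no.
  have {}no x : word_sum L n x -> fspan n h (z * x).
    by move=> wx; apply: contrapT => hx; apply: (no x).
  have hz : fspan n h z.
    rewrite -(mulr1 z); apply: no; apply: (word_sumW L1 (leq0n n)).
    exact: word_sum1.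
  apply: (inf n h) => y Ey.
  apply: (gen _ (fspan_stabilizer_divsubalg n h) _ y Ey _ hz) => l Ll _ [c [Ec ->]].
  rewrite mulr_suml; apply: fspan_sum => i _; rewrite -mulrA; apply: fspanM => //.
  have [x [wx ->]] := hw i (ltn_ord i); rewrite -mulrA; apply: no.
  by apply: (word_sumW L1 (ltn_ord i)); apply: word_sumM.
exists (upd h n (z * x)); split; first exact: triangular_snoc.
move=> i; rewrite ltnS leq_eqVlt /upd; case: eqP => [-> _|_ /= /hw //].
by exists x.
Qed.

End DivSubalg.

Lemma scalar_poly_comm (t : {poly K}) (p : {poly D}) :
  map_poly (in_alg D) t * p = p * map_poly (in_alg D) t.
Proof.
apply/polyP => i; rewrite coefM coefMr; apply: eq_bigr => j _.
by rewrite coef_map /= mulr_algl mulr_algr.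
Qed.

Lemma scalar_poly_neq0 (t : {poly K}) : t != 0 -> map_poly (in_alg D) t != 0.
Proof. by rewrite map_poly_eq0. Qed.

(** The reason for polynomial scalars: generic choices need infinitely many of them even when [K] is
    finite. *)
Lemma poly_infinite (s : seq {poly K}) : exists t, t \notin s.
Proof.
exists 'X^(\max_(p <- s) size p); apply/negP => h.
have := @leq_bigmax_seq _ s (fun=> true) (fun p : {poly K} => size p) _ h isT.
by rewrite size_polyXn ltnn.
Qed.

End PolynomialScalars.

(** * Linear algebra over the base field *)

Definition kfree (K : fieldType) (W : lmodType K) n (e : nat -> W) : Prop :=
  forall k : nat -> K, \sum_(i < n) k i *: e i = 0 -> forall i, (i < n)%N -> k i = 0.

Definition kspan (K : fieldType) (W : lmodType K) n (e : nat -> W) (y : W) : Prop :=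
  exists k : nat -> K, y = \sum_(i < n) k i *: e i.

Lemma kspan0 (K : fieldType) (W : lmodType K) n (e : nat -> W) : kspan n e 0.
Proof. by exists (fun=> 0); rewrite big1 // => i _; rewrite scale0r. Qed.

Lemma kspanD (K : fieldType) (W : lmodType K) n (e : nat -> W) x y :
  kspan n e x -> kspan n e y -> kspan n e (x + y).
Proof.
move=> [k ->] [l ->]; exists (fun i => k i + l i).
by rewrite -big_split; apply: eq_bigr => i _; rewrite scalerDl.
Qed.

Lemma kspanZ (K : fieldType) (W : lmodType K) n (e : nat -> W) a x :
  kspan n e x -> kspan n e (a *: x).
Proof.
move=> [k ->]; exists (fun i => a * k i).
by rewrite scaler_sumr; apply: eq_bigr => i _; rewrite scalerA.
Qed.

Lemma kspan_sum (K : fieldType) (W : lmodType K) n (e : nat -> W)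
    (I : Type) (r : seq I) (Q : pred I) (F : I -> W) :
  (forall i, Q i -> kspan n e (F i)) -> kspan n e (\sum_(i <- r | Q i) F i).
Proof. by move=> hF; apply: big_ind => //; [exact: kspan0 | exact: kspanD]. Qed.

Lemma kspan_gen (K : fieldType) (W : lmodType K) n (e : nat -> W) i :
  (i < n)%N -> kspan n e (e i).
Proof.
move=> i_n; exists (fun j => (j == i)%:R).
rewrite (bigD1 (Ordinal i_n)) //= eqxx scale1r big1 ?addr0 // => j.
by rewrite -val_eqE /= => /negPf ->; rewrite scale0r.
Qed.

Lemma kspan_dependent (K : fieldType) (W : lmodType K) n (e : nat -> W) m (e' : nat -> W) :
  (n < m)%N -> (forall i, (i < m)%N -> kspan n e (e' i)) -> ~ kfree m e'.
Proof.
move=> nm sp free.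
have /choice[k kP] (i : 'I_m) : exists k : nat -> K, e' i = \sum_(j < n) k j *: e j.
  exact: sp.
have [|||||c [_ [i0 ci0] cF]] := @ore_dependent K (fun=> True) _ _ _ 'I_m 'I_n (fun i j => k i j).
- move=> x y /eqP; rewrite mulf_eq0 => /orP[] /eqP; by [left|right].
- by split.
- by move=> x y _ _ y0; exists y, x; split => //; exact: mulrC.
- by rewrite !card_ord.
- by [].
pose c' j := if insub j is Some i then c i else 0.
have c'E (i : 'I_m) : c' i = c i by rewrite /c' valK.
move/eqP: ci0; apply; rewrite -c'E; apply: free => //.
transitivity (\sum_(i < m) \sum_(j < n) (c i * k i j) *: e j).
  apply: eq_bigr => i _; rewrite c'E kP scaler_sumr.
  by apply: eq_bigr => j _; rewrite scalerA.
rewrite exchange_big big1 //= => j _.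
by rewrite -scaler_suml cF scale0r.
Qed.

(** A subspace of maximal dimension inside [P] is all of [P], since any further vector would enlarge
    it. *)
Lemma vspace_of_pred (K : fieldType) (V : vectType K) (P : V -> Prop) :
  P 0 -> (forall k u v, P u -> P v -> P (k *: u + v)) ->
  exists U : {vspace V}, forall v, v \in U <-> P v.
Proof.
move=> P0 PZD.
pose Q d := `[< exists U : {vspace V}, \dim U = d /\ forall v, v \in U -> P v >].
have exQ : exists d, Q d.
  exists 0%N; apply/asboolP; exists 0%VS; split; first exact: dimv0.
  by move=> v; rewrite memv0 => /eqP ->.
have bQ d : Q d -> (d <= \dim {:V})%N.
  by move=> /asboolP[U [<- _]]; apply: dimvS; apply: subvf.
case: (ex_maxnP exQ bQ) => d /asboolP[U [dU UP]] dmax.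
exists U => v; split; first exact: UP.
move=> Pv; apply: contrapT => /negP vU.
have : Q (\dim (<[v]> + U)).
  apply/asboolP; exists (<[v]> + U)%VS; split => // w.
  by move=> /memv_addP[_ /vlineP[k ->] [u uU ->]]; apply: PZD => //; apply: UP.
move=> /dmax; rewrite -dU leqNgt => /negP; apply.
rewrite ltn_neqAle dimvS ?addvSr // andbT; apply: contra vU => /eqP e.
have /eqP -> : (U == <[v]> + U)%VS by rewrite eqEdim addvSr e leqnn.
by rewrite (subvP (addvSl _ _)) // memv_line.
Qed.

(** * Rank over a division subalgebra bounds dimension growth under its generators *)

Section Exactness.
Variables (K : fieldType) (D : unitAlgType K).
Hypothesis divD : is_division_ring D.
Variables (E : D -> Prop) (S : seq D).
Hypotheses (subE : is_divsubalg E) (SE : forall x, x \in S -> E x).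
Hypothesis genE : forall T, is_divsubalg T -> (forall x, x \in S -> T x) ->
  forall x, E x -> T x.
Hypothesis infE : forall n, exists g : nat -> D, kfree n g /\ forall i, (i < n)%N -> E (g i).

Let subrE := divsubalg_subring subE.

(* The pigeonhole on powers of [d] from [fspan_stableV], now in the quotient
   [Z / F], which is finite-dimensional over [K]. *)
Lemma relative_stableV n (e : nat -> D) (F Z : D -> Prop) d :
  F 0 -> (forall x y, F x -> F y -> F (x + y)) -> (forall a x, E a -> F x -> F (a * x)) ->
  (forall x y, Z x -> Z y -> Z (x + y)) -> (forall k x, Z x -> Z (k *: x)) ->
  (forall x, F x -> Z x) ->
  (forall x, Z x -> exists h y, [/\ F h, kspan n e y & x = h + y]) ->
  E d -> d != 0 -> (forall x, Z x -> Z (d * x)) -> forall x, Z x -> Z (d^-1 * x).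
Proof.
move=> F0 FD FM ZD ZZ FZ fin Ed d0 st x Zx.
have FZs k y : F y -> F (k *: y).
  by move=> Fy; rewrite -mulr_algl; apply: FM => //; apply: divsubalg_scalar.
have FS (I : Type) (r : seq I) (Q : pred I) G : (forall i, Q i -> F (G i)) ->
    F (\sum_(i <- r | Q i) G i).
  by move=> h; apply: big_ind.
have ZS (I : Type) (r : seq I) (Q : pred I) G : (forall i, Q i -> Z (G i)) ->
    Z (\sum_(i <- r | Q i) G i).
  by move=> h; apply: big_ind => //; apply: FZ.
have Zd i : Z (d ^+ i * x).
  by elim: i => [|i IH]; rewrite ?mul1r // exprS -mulrA; apply: st.
have /choice[hy hyP] (i : nat) : exists hy : D * D,
    [/\ F hy.1, kspan n e hy.2 & d ^+ i * x = hy.1 + hy.2].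
  by have [h [y ?]] := fin _ (Zd i); exists (h, y).
have := @kspan_dependent _ _ n e n.+1 (fun i => (hy i).2) (ltnSn n).
move=> /(_ _)/existsNP[|k /not_implyP[s0 nz]]; first by move=> i _; case: (hyP i).
have ex : exists i, (i < n.+1)%N && (k i != 0).
  apply: contrapT => no; apply: nz => i i_n.
  by apply/eqP/negP => /negP ki; apply: no; exists i; rewrite i_n.
case: (ex_minnP ex) => p /andP[pn kp] pmin.
have dp : d ^+ p.+1 \is a GRing.unit by rewrite unitrX // divD.
pose w := \sum_(i < n.+1) k i *: (d ^+ i * x).
have Fw : F w.
  have -> : w = \sum_(i < n.+1) k i *: (hy i).1 + \sum_(i < n.+1) k i *: (hy i).2.
    by rewrite -big_split; apply: eq_bigr => i _; case: (hyP i) => _ _ ->; rewrite scalerDr.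
  by rewrite s0 addr0; apply: FS => i _; apply: FZs; case: (hyP i).
suff e1 : k p *: (d^-1 * x) = (d ^+ p.+1)^-1 * w -
    \sum_(i < n.+1 | (p < i)%N) k i *: (d ^+ (i - p.+1) * x).
  rewrite -(scalerK kp (d^-1 * x)) e1; apply: (ZZ); apply: ZD.
    apply: FZ; apply: FM => //.
    apply: divsubalgV => //; last by apply: contraTneq dp => ->; rewrite unitr0.
    by elim: (p.+1) => [|i IH]; [exact: subring_pred1 | rewrite exprS; exact: subring_predM].
  by rewrite -scaleN1r; apply: (ZZ); apply: ZS => i _; apply: (ZZ).
apply: (mulrI dp); rewrite mulrBr mulVKr // /w (bigID (fun i : 'I_n.+1 => (p < i)%N)) /=.
rewrite mulr_sumr [X in X + _ - _](eq_bigr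
  (fun i : 'I_n.+1 => d ^+ p.+1 * (k i *: (d ^+ (i - p.+1) * x)))); last first.
  by move=> i pi; rewrite -scalerAr mulrA -exprD subnKC.
rewrite addrC addKr (bigD1 (Ordinal pn)) /= ?ltnn // big1 ?addr0.
  by rewrite -scalerAr exprSr -!mulrA mulVKr // divD.
move=> i /andP[]; rewrite -leqNgt leq_eqVlt -val_eqE /= => /orP[/eqP ->|ip]; rewrite ?eqxx //.
move=> _; have [->|ki] := eqVneq (k i) 0; first by rewrite scale0r.
by have := pmin i; rewrite ltn_ord ki => /(_ isT); rewrite leqNgt ip.
Qed.

Variables (N : nat) (phi : {linear 'rV[K]_N -> D}).
Variables (X : {vspace 'rV[K]_N}).
Hypothesis SX : forall g x, g \in S -> x \in X -> exists y, phi y = g * phi x.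

Lemma image_kspan (y : 'rV[K]_N) :
  kspan N (fun j => if insub j is Some i then phi (delta_mx 0 i) else 0) (phi y).
Proof.
exists (fun j => if insub j is Some i then y 0 i else 0).
rewrite {1}(row_sum_delta y) linear_sum; apply: eq_bigr => i _.
by rewrite valK linearZ.
Qed.

(* Otherwise [F + phi (X :&: g)] would be stable under [S], hence under [E], so
   that the infinite-dimensional [E * phi x] would be finite-dimensional modulo [F]. *)
Lemma flag_step (F G : D -> Prop) (f g : {vspace 'rV[K]_N}) x :
  F 0 -> (forall x y, F x -> F y -> F (x + y)) -> (forall a x, E a -> F x -> F (a * x)) ->
  (forall a x, E a -> G x -> G (a * x)) ->
  (forall v, v \in f <-> F (phi v)) -> (forall v, v \in g <-> G (phi v)) ->
  x \in X -> G (phi x) -> ~ F (phi x) -> ~ (g <= f + (X :&: g))%VS.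
Proof.
move=> F0 FD FM GM fP gP xX Gx nFx sub.
pose Z y := exists h u, [/\ F h, u \in (X :&: g)%VS & y = h + phi u].
have FZs k y : F y -> F (k *: y).
  by move=> Fy; rewrite -mulr_algl; apply: FM => //; apply: divsubalg_scalar.
have ZD y z : Z y -> Z z -> Z (y + z).
  move=> [h [u [Fh uX ->]]] [h' [u' [Fh' uX' ->]]]; exists (h + h'), (u + u').
  by split; [exact: FD | exact: memvD | rewrite linearD addrACA].
have ZZ k y : Z y -> Z (k *: y).
  move=> [h [u [Fh uX ->]]]; exists (k *: h), (k *: u).
  by split; [exact: FZs | exact: memvZ | rewrite linearZ scalerDr].
have FZ y : F y -> Z y.
  by move=> Fy; exists y, 0; split; rewrite ?mem0v // linear0 addr0.
(* Membership in [E] is carried along because closure under inverses, through [relative_stableV],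
   requires it. *)
have stabE : forall d, E d -> E d /\ forall y, Z y -> Z (d * y).
  apply: (genE (T := fun d => E d /\ forall y, Z y -> Z (d * y))).
    split=> [k|]; first by split; [exact: divsubalg_scalar | move=> y; rewrite mulr_algl; exact: ZZ].
    split=> [a b [Ea ha] [Eb hb]|].
      split; first exact: subring_predD.
      by move=> y Zy; rewrite mulrDl; apply: ZD; [exact: ha | exact: hb].
    split=> [a [Ea ha]|].
      split; first exact: subring_predN.
      by move=> y Zy; rewrite mulNr -scaleN1r; apply: (ZZ); exact: ha.
    split=> [a b [Ea ha] [Eb hb]|a [Ea ha] a0].
      split; first exact: subring_predM.
      by move=> y Zy; rewrite -mulrA; apply: ha; apply: hb.
    split; first exact: divsubalgV.
    apply: (relative_stableV F0 FD FM ZD ZZ FZ _ Ea a0 ha) => y [h [u [Fh _ ->]]].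
    by exists h, (phi u); split => //; exact: image_kspan.
  move=> s sS; split; first exact: SE.
  move=> _ [h [u [Fh uX ->]]]; rewrite mulrDr; apply: ZD.
    by apply: FZ; apply: FM => //; exact: SE.
  move: uX; rewrite memv_cap => /andP[uX /gP Gu].
  have [v vE] := SX sS uX.
  have /(subvP sub) /memv_addP[a /fP Fa [b bX ve]] : v \in g.
    by apply/gP; rewrite vE; apply: GM => //; exact: SE.
  by rewrite -vE ve linearD; exists (phi a), b.
have Zx : Z (phi x).
  by exists 0, x; split; rewrite ?add0r // memv_cap xX; apply/gP.
(* Modulo [F], the [N.+1] vectors [e i * phi x] lie in the image of [phi], which has dimension at
   most [N]. A relation gives a nonzero [a] in [E] with [a * phi x] in [F], and dividing by [a] puts
   [phi x] in [F]. *)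
have [e [fe Ee]] := infE N.+1.
have /choice[hu huP] (i : 'I_N.+1) : exists hu : D * 'rV[K]_N,
    F hu.1 /\ e i * phi x = hu.1 + phi hu.2.
  have [_ /(_ _ Zx) [h [u [Fh _ eq]]]] := stabE _ (Ee i (ltn_ord i)).
  by exists (h, u).
pose u j := if insub j is Some i then phi (hu i).2 else 0.
have := @kspan_dependent _ _ N _ N.+1 u (ltnSn N) _.
move=> /(_ (fun j => if insub j is Some i then phi (delta_mx 0 i) else 0)) /(_ _)/existsNP[|k].
  by move=> i iN; rewrite /u insubT; exact: image_kspan.
move=> /not_implyP[s0 nz]; apply: nz => i iN.
apply: contrapT => /eqP ki.
have a0 : \sum_(i < N.+1) k i *: e i != 0.
  apply/eqP => /fe /(_ i iN) /eqP; by rewrite (negPf ki).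
apply: nFx; rewrite -[phi x](mulKr (divD a0)); apply: FM.
  apply: divsubalgV => //; apply: subring_pred_sum => // j _.
  by apply: divsubalgZ => //; apply: Ee.
have -> : (\sum_(i < N.+1) k i *: e i) * phi x = \sum_(i < N.+1) k i *: (hu i).1.
  transitivity (\sum_(i < N.+1) k i *: (hu i).1 + \sum_(i < N.+1) k i *: u i);
    last by rewrite s0 addr0.
  rewrite mulr_suml -big_split; apply: eq_bigr => j _ /=.
  by rewrite /u valK -scalerDr -scalerAl; case: (huP j) => _ ->.
by apply: big_ind => // j _; apply: FZs; case: (huP j).
Qed.

(** Let [f t] be the preimage of the [E]-span of the first [t] vectors. By [flag_step], passing to
    [f t.+1] adds more dimensions to [f t] than to [X :&: f t]; after [r] steps the dimension
    formula for [X + f r] gives the bound. *)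
Lemma exactness r (h : nat -> D) : triangular E r h ->
  (forall i, (i < r)%N -> exists x, x \in X /\ phi x = h i) -> (\dim X + r <= N)%N.
Proof.
move=> th hX.
have /choice[f fP] t : exists f : {vspace 'rV[K]_N}, forall v, v \in f <-> fspan E t h (phi v).
  apply: vspace_of_pred; first by rewrite linear0; exact: fspan0.
  move=> k u v hu hv; rewrite linearD linearZ /=; apply: fspanD => //.
  by rewrite -[_ *: _]mulr_algl; apply: fspanM => //; exact: divsubalg_scalar.
have fS t : (f t <= f t.+1)%VS.
  apply/subvP => v /fP[c [Ec e]]; apply/fP.
  exists (fun i => if (i < t)%N then c i else 0); split.
    by move=> i; case: ifP => _ //; exact: (subring_pred0 subrE).
  rewrite big_ord_recr /= ltnn mul0r addr0 e; apply: eq_bigr => i _.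
  by rewrite ltn_ord.
have ind t : (t <= r)%N -> (\dim (X :&: f t) + t <= \dim (f t))%N.
  elim: t => [|t IH] tr; first by rewrite addn0 dimvS // capvSr.
  have [x [xX xE]] := hX t tr.
  have proper : ~ (f t.+1 <= f t + (X :&: f t.+1))%VS.
    apply: (@flag_step (fspan E t h) (fspan E t.+1 h) _ _ x) => //.
    - exact: fspan0.
    - by move=> ? ?; exact: fspanD.
    - by move=> ? ?; exact: fspanM.
    - by move=> ? ?; exact: fspanM.
    - by rewrite xE; apply: fspan_gen.
    - by rewrite xE; apply: th.
  have := dimv_sum_cap (f t) (X :&: f t.+1).
  rewrite [(f t :&: _)%VS]capvC -capvA (capv_idPr (fS t)).
  have : (\dim (f t + (X :&: f t.+1)) < \dim (f t.+1))%N.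
    have le : (f t + (X :&: f t.+1) <= f t.+1)%VS by rewrite subv_add fS capvSr.
    rewrite ltn_neqAle dimvS // andbT; apply/eqP => e; apply: proper.
    have /eqP -> // : (f t + (X :&: f t.+1) == f t.+1)%VS by rewrite eqEdim le e leqnn.
  by move=> lt e; have := IH (ltnW tr); lia.
have := dimv_sum_cap X (f r).
have : (\dim (X + f r) <= N)%N.
  by apply: leq_trans (dimvS (subvf _)) _; rewrite dimvf /dim /= mul1n.
by move=> le e; have := ind r (leqnn r); lia.
Qed.

End Exactness.

(** * Coordinates of vectors and of polynomials *)

Section LinearCombination.
Variables (K : fieldType) (D : unitAlgType K) (N : nat) (e : nat -> D).

Definition lincomb (c : 'rV[K]_N) : D := \sum_(i < N) c 0 i *: e i.

Lemma lincomb_linear : linear lincomb.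
Proof.
move=> k u v; rewrite /lincomb scaler_sumr -big_split; apply: eq_bigr => i _.
by rewrite !mxE scalerDl scalerA.
Qed.

HB.instance Definition _ :=
  GRing.isLinear.Build K 'rV[K]_N D *:%R lincomb lincomb_linear.

Lemma kspan_lincomb y : kspan N e y -> exists c, lincomb c = y.
Proof.
move=> [k ->]; exists (\row_i k i); apply: eq_bigr => i _.
by rewrite mxE.
Qed.
End LinearCombination.

Section PolynomialCoordinates.
Variables (K : fieldType) (D : unitAlgType K).
Local Notation iota := (map_poly (in_alg D)).

Lemma kspan_poly N (e : nat -> D) (p : {poly D}) : (forall i, kspan N e p`_i) ->
  exists v : nat -> {poly K}, p = \sum_(l < N) iota (v l) * (e l)%:P.
Proof.
move=> /choice[k kP]; exists (fun l => \poly_(i < size p) k i l).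
apply/polyP => i; rewrite coef_sum.
under eq_bigr do rewrite coefMC coef_map coef_poly.
case: ltnP => ip; last first.
  by rewrite nth_default // big1 // => l _ /=; rewrite scale0r mul0r.
by rewrite kP; apply: eq_bigr => l _; rewrite mulr_algl.
Qed.

Lemma poly_kspan N (e : nat -> D) (v : nat -> {poly K}) i :
  (\sum_(l < N) iota (v l) * (e l)%:P)`_i = \sum_(l < N) (v l)`_i *: e l.
Proof.
by rewrite coef_sum; apply: eq_bigr => l _; rewrite coefMC coef_map /= mulr_algl.
Qed.

Lemma fspan_poly (E : D -> Prop) r (h : nat -> D) (p : {poly D}) :
  is_divsubalg E -> (forall i, fspan E r h p`_i) ->
  exists q : nat -> {poly D}, (forall t, coefs_in E (q t)) /\
    p = \sum_(t < r) q t * (h t)%:P.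
Proof.
move=> subE /choice[c cP]; exists (fun t => \poly_(i < size p) c i t); split.
  move=> t i; rewrite coef_poly; case: ifP => _; first by case: (cP i).
  exact: (subring_pred0 (divsubalg_subring subE)).
apply/polyP => i; rewrite coef_sum.
under eq_bigr do rewrite coefMC coef_poly.
case: ltnP => ip; first by case: (cP i).
by rewrite nth_default // big1 // => l _; rewrite mul0r.
Qed.

Lemma coefM_top (p q : {poly D}) a b : (size p <= a.+1)%N -> (size q <= b.+1)%N ->
  (p * q)`_(a + b) = p`_a * q`_b.
Proof.
move=> pa qb; have ab : (a < (a + b).+1)%N by rewrite ltnS leq_addr.
rewrite coefM (bigD1 (Ordinal ab)) //= addKn big1 ?addr0 // => i.
rewrite -val_eqE /= => ia; have [lt|gt|eq] := ltngtP i a.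
- by rewrite [q`_ _]nth_default ?mulr0 // (leq_trans qb) //; lia.
- by rewrite [p`_ _]nth_default ?mul0r // (leq_trans pa).
- by rewrite eq eqxx in ia.
Qed.

(** In a relation whose coefficients have size at most [M.+1], the coefficient of degree
    [M + (size y).-1] is a relation between the [lead_coef y * x j]; so the bound on the sizes can
    be lowered step by step to zero. *)
Lemma lfree_lead (E : D -> Prop) (y : {poly D}) n (x : nat -> D) :
  is_divsubalg E -> y != 0 -> lfree E n (fun j => lead_coef y * x j) ->
  lfree (coefs_in E) n (fun j => y * (x j)%:P).
Proof.
move=> subE y0 fx g Eg s0.
suff ind M : (forall i, (i < n)%N -> (size (g i) <= M)%N) -> forall i, (i < n)%N -> g i = 0.
  apply: (ind (\max_(i < n) size (g i))%N) => i i_n.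
  by rewrite (leq_bigmax (Ordinal i_n)).
elim: M => [|M IH] gM; first by move=> i /gM; rewrite leqn0 size_poly_eq0 => /eqP.
apply: IH => i i_n; apply/leq_sizeP => j; rewrite leq_eqVlt => /orP[/eqP <-|Mj]; last first.
  by rewrite nth_default // (leq_trans (gM i i_n)).
apply: (fx (fun i => (g i)`_M)) => // [l|]; first exact: Eg.
transitivity ((\sum_(i < n) g i * (y * (x i)%:P))`_(M + (size y).-1)); last first.
  by rewrite s0 coef0.
rewrite coef_sum; apply: eq_bigr => l _.
rewrite coefM_top ?gM ?coefMC // prednK ?size_poly_gt0 //.
apply: leq_trans (size_polyMleq _ _) _.
have := size_polyC_leq1 (x l); have : (0 < size y)%N by rewrite size_poly_gt0.
by move=> ? ?; lia.
Qed.
End PolynomialCoordinates.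

(** * The key inequality between increments of the growth function *)

Section KeyInequality.
Variables (K : fieldType) (D : unitAlgType K).
Hypothesis divD : is_division_ring D.
Local Notation iota := (map_poly (in_alg D)).

Variables (U : nat -> D -> Prop) (d : nat -> nat) (beta : nat -> nat -> D).
Hypothesis U_span : forall n x, U n x <-> kspan (d n) (beta n) x.
Hypothesis beta_free : forall n, kfree (d n) (beta n).
Hypothesis U01 : U 0 1.
Hypothesis UM : forall m n x y, U m x -> U n y -> U (m + n)%N (x * y).
Hypothesis U_mono : forall m n x, (m <= n)%N -> U m x -> U n x.
Hypothesis U_gen : forall T, is_divsubalg T -> (forall x, U 1 x -> T x) -> forall x, T x.

Variables (E1 E2 E3 : D -> Prop) (S1 S2 : seq D).
Hypotheses (subE1 : is_divsubalg E1) (subE2 : is_divsubalg E2).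
Hypothesis E12 : forall x, E1 x -> E2 x.
Hypotheses (SE1 : forall x, x \in S1 -> E1 x) (SE2 : forall x, x \in S2 -> E2 x).
Hypothesis gen1 : forall T, is_divsubalg T -> (forall x, x \in S1 -> T x) ->
  forall x, E1 x -> T x.
Hypothesis gen2 : forall T, is_divsubalg T -> (forall x, x \in S2 -> T x) ->
  forall x, E2 x -> T x.
Hypothesis inf1 : forall n, exists g : nat -> D, kfree n g /\ forall i, (i < n)%N -> E1 (g i).
Hypothesis inf2 : ~ left_findim E1 E2.
Hypothesis inf3 : ~ left_findim E2 E3.

Variables (s : D) (k : nat).
Hypothesis s0 : s != 0.
Hypothesis denom : forall w, w \in (1 :: S1 ++ S2) -> U k (w * s).

Definition sU n x := exists u, U n u /\ x = s * u.

Lemma U_add n x y : U n x -> U n y -> U n (x + y).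
Proof. by move=> /U_span ? /U_span ?; apply/U_span; apply: kspanD. Qed.

Lemma U_scale n a x : U n x -> U n (a *: x).
Proof. by move=> /U_span ?; apply/U_span; apply: kspanZ. Qed.

Lemma U_sum n (I : Type) (r : seq I) (Q : pred I) (F : I -> D) :
  (forall i, Q i -> U n (F i)) -> U n (\sum_(i <- r | Q i) F i).
Proof. by move=> h; apply/U_span; apply: kspan_sum => i /h /U_span. Qed.

Lemma beta_U n i : (i < d n)%N -> U n (beta n i).
Proof. by move=> i_n; apply/U_span; apply: kspan_gen. Qed.

Lemma sbeta_free n : kfree (d n) (fun i => s * beta n i).
Proof.
move=> c e; apply: beta_free; apply: (mulrI (divD s0)); rewrite mulr0 -[RHS]e.
by rewrite mulr_sumr; apply: eq_bigr => i _; rewrite scalerAr.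
Qed.

Local Notation phi m := (@lincomb K D (d (m + k)%N) (beta (m + k)%N)).

(** [exactness] in the coordinate space of [U (m + k)]: there [X] is the copy of [s * U m], of
    dimension [d m] because left multiplication by [s] is injective. *)
Lemma rank_boundary m r h : triangular E1 r h -> (forall i, (i < r)%N -> sU m (h i)) ->
  (d m + r <= d (m + k))%N.
Proof.
move=> th hU.
have sUk x : sU m x -> kspan (d (m + k)%N) (beta (m + k)%N) x.
  move=> [u [Uu ->]]; apply/U_span; rewrite addnC; apply: UM => //.
  by rewrite -(mul1r s); apply: denom; rewrite inE eqxx.
have /choice[y yP] (i : 'I_(d m)) : exists y, phi m y = s * beta m i.
  apply: kspan_lincomb; apply: sUk; exists (beta m i); split => //; exact: beta_U.
have phi_y (c : nat -> K) : phi m (\sum_(i < d m) c i *: y i) = s * \sum_(i < d m) c i *: beta m i.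
  rewrite linear_sum mulr_sumr; apply: eq_bigr => i _.
  by rewrite linearZ /= yP scalerAr.
pose X := <<[tuple y i | i < d m]>>%VS.
have freey : free [tuple y i | i < d m].
  apply/freeP => c e i; pose c' j := if insub j is Some l then c l else 0.
  have -> : c i = c' i by rewrite /c' valK.
  apply: (@sbeta_free m) => //.
  rewrite -[RHS](linear0 (phi m)) -e linear_sum.
  apply: eq_bigr => l _; rewrite linearZ -tnth_nth tnth_mktuple /=.
  by rewrite yP /c' valK.
have dimX : \dim X = d m by move/eqP: freey; rewrite size_tuple.
have XP x : x \in X -> sU m (phi m x).
  move=> /coord_span ->; exists (\sum_(i < d m) coord [tuple y i | i < d m] i x *: beta m i).
  split; first by apply: U_sum => i _; apply: U_scale; apply: beta_U.
  rewrite linear_sum mulr_sumr; apply: eq_bigr => i _.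
  by rewrite linearZ -tnth_nth tnth_mktuple /= yP scalerAr.
rewrite -dimX; apply: (exactness divD subE1 SE1 gen1 inf1 (phi := phi m)) th _.
  move=> g x gS /XP [u [Uu e]]; apply: kspan_lincomb; apply/U_span.
  rewrite (_ : g * _ = g * (s * u)); last by congr (_ * _).
  rewrite mulrA addnC; apply: UM => //; apply: denom.
  by rewrite inE mem_cat gS orbT.
move=> i /hU [u [/U_span [c ->] ->]]; exists (\sum_(i < d m) c i *: y i); split; last exact: phi_y.
apply: memv_suml => j _; apply: memvZ; apply: memv_span.
by apply/tnthP; exists j; rewrite tnth_mktuple.
Qed.

Lemma d_mono m : (d m <= d (m + k))%N.
Proof. by rewrite -[leqLHS]addn0; apply: (@rank_boundary m 0 (fun=> 0)) => i. Qed.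

Lemma d_strict m : (d m < d (m + k))%N.
Proof.
rewrite -addn1; apply: (@rank_boundary m 1 (fun=> s)).
  move=> i; rewrite ltnS leqn0 => /eqP -> [c [_ e]].
  by move/eqP: s0; rewrite e big_ord0.
by move=> i _; exists 1; rewrite mulr1; split => //; apply: U_mono U01.
Qed.

(** [rank_boundary] bounds the length of independent families, so a longest one exists, and it
    spans. *)
Lemma maximal_rank m : exists r h, (d m + r <= d (m + k))%N /\
  forall x, sU m x -> fspan E1 r h x.
Proof.
pose Q r := `[< exists h, triangular E1 r h /\ forall i, (i < r)%N -> sU m (h i) >].
have exQ : exists r, Q r by exists 0%N; apply/asboolP; exists (fun=> 0).
have bQ r : Q r -> (r <= d (m + k))%N.
  by move=> /asboolP[h [th hU]]; have := rank_boundary th hU; lia.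
case: (ex_maxnP exQ bQ) => r /asboolP[h [th hU]] rmax.
exists r, h; split; first exact: rank_boundary th hU.
move=> x Ux; apply: contrapT => nx.
have : Q r.+1.
  apply/asboolP; exists (upd h r x); split; first exact: triangular_snoc.
  by move=> i; rewrite ltnS leq_eqVlt /upd; case: eqP => //= _; exact: hU.
by move=> /rmax; rewrite ltnn.
Qed.

(** Including [1] allows short words to be padded and makes [sU n] part of [U (n + k)]. *)
Definition letter_coef x := kspan (size S2).+1 (fun i => (1 :: S2)`_i) x.
Definition letter (p : {poly D}) := forall i, letter_coef p`_i.

Lemma letter_coef_gen x : x \in 1 :: S2 -> letter_coef x.
Proof.
move=> xS; rewrite -(nth_index 0 xS).
by apply: (@kspan_gen _ _ _ (fun i => (1 :: S2)`_i)); rewrite -index_mem in xS.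
Qed.

Lemma letter_coefE2 x : letter_coef x -> E2 x.
Proof.
move=> [c ->]; apply: (subring_pred_sum (divsubalg_subring subE2)) => i _.
apply: divsubalgZ => //; have := mem_nth 0 (ltn_ord i : (i < size (1 :: S2)%R)%N).
rewrite inE => /orP[/eqP ->|/SE2 //]; exact: (subring_pred1 (divsubalg_subring subE2)).
Qed.

Lemma letter_coef_sU n x y : letter_coef x -> sU n y -> U (n + k)%N (x * y).
Proof.
move=> [c ->] [u [Uu ->]]; rewrite mulr_suml; apply: U_sum => i _.
rewrite -scalerAl; apply: U_scale; rewrite mulrA addnC; apply: UM => //; apply: denom.
have := mem_nth 0 (ltn_ord i : (i < size (1 :: S2)%R)%N).
by rewrite !inE mem_cat => /orP[->|->]; rewrite ?orbT.
Qed.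

(** [generic_path_free] over [{poly D}] with central scalars [{poly K}]. Its supply of independent
    words comes from [words_triangular] with [z = 1], as [S2] generates [E2], which is infinite over
    [E1]. *)
Lemma free_letter_path p : exists b, (forall i, letter (b i)) /\
  lfree (coefs_in E1) p.+1 (path_node b).
Proof.
have LC : letter_coef 1 by apply: letter_coef_gen; rewrite inE eqxx.
have LCP x : letter_coef x -> letter x%:P.
  by move=> Lx i; rewrite coefC; case: eqP => // _; exact: kspan0.
apply: (@generic_path_free _ (coefs_in E1) (poly_nzd divD) (coefs_in_subring subE1)
  (coefs_in_ore divD subE1) _ iota).
- exact: scalar_poly_comm.
- exact: coefs_in_scalar.
- exact: scalar_poly_neq0.
- exact: poly_infinite.
- exact: LCP.
- by move=> x y Lx Ly i; rewrite coefD; apply: kspanD; [exact: Lx | exact: Ly].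
- move=> t x Lx i; rewrite coefM; apply: kspan_sum => j _.
  by rewrite coef_map /= mulr_algl; apply: kspanZ; apply: Lx.
- move=> r.
  have [|||h [th hw]] := @words_triangular _ _ divD E1 subE1 letter_coef E2 1 _ LC _ _ r.
  + exact: oner_neq0.
  + move=> T subT LT; apply: gen2 => // x xS; apply: LT; apply: letter_coef_gen.
    by rewrite inE xS orbT.
  + move=> n h sp; have [g [tg Eg]] := infinite_triangular inf2 n.+1.
    apply: (fspan_dependent divD subE1 (ltnSn n) (h := h) (h' := g)); last exact: triangular_lfree.
    by move=> i i_n; rewrite -(mul1r (g i)); apply: sp; apply: Eg.
  exists r, (fun i => (h i)%:P); split; first by apply: lfree_polyC; apply: triangular_lfree.
  move=> i ir; have [x [wx ->]] := hw i ir; rewrite mul1r.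
  apply: (word_sumW (LCP _ LC) (ltnW ir)).
  elim: wx => [|j y l _ IH Ll|j y y' _ IH _ IH'].
  + exact: word_sum1.
  + by rewrite polyCM; apply: word_sumM => //; apply: LCP.
  + by rewrite polyCD; apply: word_sumD.
Qed.

(* Over [{poly K}], the relations [y_(i+1) = b_i * y_i] between polynomials
   [y_0, ..., y_p] with coefficients in [sU n] are [p * d (n + k)] linear
   equations in [p.+1 * d n] unknowns. *)
Lemma path_in_sU n p (b : nat -> {poly D}) : (forall i, letter (b i)) ->
  (p * (d (n + k) - d n) < d n)%N ->
  exists y : {poly D}, y != 0 /\
    forall i, (i <= p)%N -> forall q, sU n (path_node b i * y)`_q.
Proof.
move=> Lb pd.
have sUk x : sU n x -> kspan (d (n + k)%N) (beta (n + k)%N) x.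
  move=> Ux; apply/U_span; rewrite -(mul1r x); apply: letter_coef_sU => //.
  by apply: letter_coef_gen; rewrite inE eqxx.
have sUb j : (j < d n)%N -> sU n (s * beta n j).
  by move=> jd; exists (beta n j); split => //; apply: beta_U.
have /choice[Sm SmP] (j : 'I_(d n)) : exists v : nat -> {poly K},
    (s * beta n j)%:P = \sum_(l < d (n + k)%N) iota (v l) * (beta (n + k)%N l)%:P.
  apply: kspan_poly => i; rewrite coefC; case: eqP => _; last exact: kspan0.
  by apply: sUk; apply: sUb.
have /choice[B BP] (ij : 'I_p * 'I_(d n)) : exists v : nat -> {poly K},
    b ij.1 * (s * beta n ij.2)%:P =
      \sum_(l < d (n + k)%N) iota (v l) * (beta (n + k)%N l)%:P.
  apply: kspan_poly => i; rewrite coefMC; apply/U_span.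
  by apply: letter_coef_sU; [exact: Lb | apply: sUb].
(* The unknown [(i, j)] is the coefficient of [s * beta n j] in [y i]; the equation [(i, l)] is the
   [l]-th coordinate of [b_i * y_i - y_(i+1)] in the basis of [U (n + k)]. *)
pose F (ij : 'I_p.+1 * 'I_(d n)) (il : 'I_p * 'I_(d (n + k)%N)) : {poly K} :=
  (if ij.1 == widen_ord (leqnSn p) il.1 then B (il.1, ij.2) il.2 else 0) -
  (if ij.1 == lift ord0 il.1 then Sm ij.2 il.2 else 0).
have [|||||v [_ [ij0 v0] vF]] := @ore_dependent {poly K} (fun=> True) _ _ _ _ _ F.
- move=> x y /eqP; rewrite mulf_eq0 => /orP[] /eqP; by [left|right].
- by split.
- by move=> x y _ _ y0; exists y, x; split => //; exact: mulrC.
(* The hypothesis [pd] is [p * d (n + k) < p.+1 * d n] in disguise: fewer equations than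
   unknowns. *)
- rewrite !card_prod !card_ord; have := d_mono n.
  by move: pd; move: (d n) (d (n + k)%N) => a c; nia.
- by [].
pose w (i : 'I_p.+1) (l : nat) : {poly K} := if insub l is Some j then v (i, j) else 0.
have wE i (j : 'I_(d n)) : w i j = v (i, j) by rewrite /w valK.
pose y (i : 'I_p.+1) : {poly D} := \sum_(j < d n) iota (w i j) * (s * beta n j)%:P.
have ysU i q : sU n (y i)`_q.
  rewrite (poly_kspan (d n) (fun j => s * beta n j)).
  exists (\sum_(j < d n) (w i j)`_q *: beta n j); split.
    by apply: U_sum => j _; apply: U_scale; apply: beta_U.
  by rewrite mulr_sumr; apply: eq_bigr => j _; rewrite scalerAr.
have step (i : 'I_p) : y (lift ord0 i) = b i * y (widen_ord (leqnSn p) i).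
  have e1 : b i * y (widen_ord (leqnSn p) i) =
      \sum_(l < d (n + k)%N) iota (\sum_(j < d n) w (widen_ord (leqnSn p) i) j * B (i, j) l)
        * (beta (n + k)%N l)%:P.
    rewrite mulr_sumr.
    under eq_bigr => j _ do rewrite mulrA -scalar_poly_comm -mulrA (BP (i, j)) mulr_sumr.
    rewrite exchange_big; apply: eq_bigr => l _.
    by rewrite rmorph_sum mulr_suml; apply: eq_bigr => j _; rewrite rmorphM mulrA.
  have e2 : y (lift ord0 i) =
      \sum_(l < d (n + k)%N) iota (\sum_(j < d n) w (lift ord0 i) j * Sm j l)
        * (beta (n + k)%N l)%:P.
    rewrite /y; under eq_bigr => j _ do rewrite SmP mulr_sumr.
    rewrite exchange_big; apply: eq_bigr => l _.
    by rewrite rmorph_sum mulr_suml; apply: eq_bigr => j _; rewrite rmorphM mulrA.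
  rewrite e1 e2; apply: eq_bigr => l _; congr (iota _ * _).
  have : \sum_i' \sum_j v (i', j) * F (i', j) (i, l) = 0.
    by rewrite pair_bigA; apply: etrans (vF (i, l)); apply: eq_bigr => -[].
  rewrite (eq_bigr (fun i' =>
    (if i' == widen_ord (leqnSn p) i then \sum_j v (i', j) * B (i, j) l else 0) -
    (if i' == lift ord0 i then \sum_j v (i', j) * Sm j l else 0))); last first.
    move=> i' _; rewrite /F /=; under eq_bigr do rewrite mulrBr.
    rewrite sumrB; congr (_ - _); case: eqP => _ //; by rewrite big1 // => j _; rewrite mulr0.
  rewrite sumrB -!big_mkcond !big_pred1_eq => /eqP; rewrite subr_eq0 => /eqP e.
  under eq_bigr do rewrite wE; rewrite -e.
  by apply: eq_bigr => j _; rewrite wE.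
have yE i (ip : (i < p.+1)%N) : y (Ordinal ip) = path_node b i * y ord0.
  elim: i ip => [|i IH] ip; first by rewrite mul1r; congr y; apply: val_inj.
  have ip' : (i < p)%N by [].
  have -> : Ordinal ip = lift ord0 (Ordinal ip') by apply: val_inj.
  rewrite step /= -mulrA -(IH (ltnW ip)); congr (_ * y _).
  exact: val_inj.
exists (y ord0); split; last first.
  by move=> i ip q; have ip' : (i < p.+1)%N by []; rewrite -yE; apply: ysU.
(* If [y ord0] vanished, so would every [y i], and freeness of the [s * beta n j] would annihilate
   the nontrivial solution [v]. *)
apply/eqP => y00; move/eqP: v0; apply.
case: ij0 => i j; rewrite -wE; apply/polyP => q; rewrite coef0.
apply: (@sbeta_free n (fun j => (w i j)`_q)) => //.
transitivity ((y i)`_q); first by rewrite (poly_kspan (d n) (fun j => s * beta n j)).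
have -> : i = Ordinal (ltn_ord i) by apply: val_inj.
by rewrite yE y00 mulr0 coef0.
Qed.

Lemma word_sum_U n x : word_sum (U 1) n x -> U n x.
Proof.
elim=> [//|j y l _ IH Ul|j y y' _ IH _ IH']; last exact: U_add.
by rewrite -addn1; apply: UM.
Qed.

(** [U 1] generates [D], and [z * D = D] contains [E3], so it is infinite over [E2]. The words found
    have length at most [n], hence lie in [U n]. *)
Lemma independent_multipliers z n : z != 0 ->
  exists x, lfree E2 n.+1 (fun j => z * x j) /\ forall j, (j < n.+1)%N -> U n (x j).
Proof.
move=> z0; have [|||h [th hw]] := @words_triangular _ _ divD E2 subE2 (U 1) (fun=> True) z z0 _ _ _ n.+1.
- exact: U_mono U01.
- by move=> T subT UT x _; apply: U_gen.
- move=> m h sp; have [g [tg Eg]] := infinite_triangular inf3 m.+1.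
  apply: (fspan_dependent divD subE2 (ltnSn m) (h := h) (h' := g)); last exact: triangular_lfree.
  by move=> i _; rewrite -(mulVKr (divD z0) (g i)); apply: sp.
have /choice[x xP] (j : 'I_n.+1) : exists x, word_sum (U 1) j x /\ h j = z * x.
  exact: hw.
exists (fun j => if insub j is Some i then x i else 0); split.
  apply: lfree_ext (triangular_lfree divD subE2 th) => i i_n.
  by rewrite insubT; case: (xP (Ordinal i_n)).
move=> j jn; rewrite insubT; apply: (@U_mono j); first by rewrite -ltnS.
by apply: word_sum_U; case: (xP (Ordinal jn)).
Qed.

(** The polynomials [path_node b i * y * (x j)%:P] have coefficients in [sU m], hence in a span of
    [r] vectors over [E1]. They are independent over [E1[X]] as in a tower of extensions, so there
    are at most [r] of them. *)
Lemma rank_lower_bound n m p : (p * (d (n + k) - d n) < d n)%N -> (n + n <= m)%N ->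
  (p.+1 * n.+1 <= d (m + k) - d m)%N.
Proof.
move=> pd nm.
have [b [Lb fb]] := free_letter_path p.
have [y [y0 yU]] := path_in_sU Lb pd.
have ly0 : lead_coef y != 0 by rewrite lead_coef_eq0.
have [x [fx xU]] := independent_multipliers n ly0.
have fyx := lfree_lead subE2 y0 fx.
have [r [h [rd hP]]] := maximal_rank m.
suff : (p.+1 * n.+1 <= r)%N by lia.
rewrite leqNgt; apply/negP => rpn.
have /choice[q qP] (ij : 'I_p.+1 * 'I_n.+1) : exists q : nat -> {poly D},
    (forall t, coefs_in E1 (q t)) /\
    path_node b ij.1 * y * (x ij.2)%:P = \sum_(t < r) q t * (h t)%:P.
  apply: fspan_poly => // i; apply: hP; rewrite coefMC.
  have [u [Uu ->]] := yU ij.1 (ltn_ord ij.1) i; rewrite -mulrA.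
  exists (u * x ij.2); split => //; apply: (U_mono nm); apply: UM => //.
  exact: xU.
have sub1 := coefs_in_subring subE1; have sub2 := coefs_in_subring subE2.
have [||c [Ec [[i0 j0] c0] cF]] := @ore_dependent _ _ (poly_nzd divD) sub1
  (coefs_in_ore divD subE1) _ 'I_r (fun ij t => q ij t).
- by rewrite card_prod !card_ord.
- by move=> ij t; case: (qP ij).
have bE2 i : coefs_in E2 (path_node b i).
  elim: i => [|i IH] /=; first exact: (subring_pred1 sub2).
  by apply: (subring_predM sub2) => // j; apply: letter_coefE2; apply: Lb.
pose c' i j : {poly D} := if insub i is Some i' then if insub j is Some j' then c (i', j')
  else 0 else 0.
have c'E (i : 'I_p.+1) (j : 'I_n.+1) : c' i j = c (i, j) by rewrite /c' !valK.
have Ec' i j : coefs_in E1 (c' i j).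
  rewrite /c'; case: insubP => [? _ _|_]; last exact: (subring_pred0 sub1).
  by case: insubP => [? _ _|_]; [exact: Ec | exact: (subring_pred0 sub1)].
(* Tower argument: grouped by [j], the relation has coefficients in [E2[X]], over which the
   [y * (x j)%:P] are independent; what remains for each [j] is a relation between path nodes over
   [E1[X]]. *)
have g0 j : (j < n.+1)%N -> \sum_(i < p.+1) c' i j * path_node b i = 0.
  move=> jn; apply: (fyx (fun j => \sum_(i < p.+1) c' i j * path_node b i)) => //.
    move=> l; apply: (subring_pred_sum sub2) => i _; apply: (subring_predM sub2) => // t.
    by apply: E12; apply: Ec'.
  transitivity (\sum_ij c ij * (path_node b ij.1 * y * (x ij.2)%:P)).
    transitivity (\sum_i \sum_j c (i, j) * (path_node b i * y * (x j)%:P)).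
      rewrite exchange_big; apply: eq_bigr => l _; rewrite mulr_suml; apply: eq_bigr => i _.
      by rewrite c'E !mulrA.
    by rewrite pair_bigA; apply: eq_bigr => -[].
  under eq_bigr => ij _ do rewrite (qP ij).2 mulr_sumr.
  rewrite exchange_big big1 //= => t _.
  by under eq_bigr do rewrite mulrA; rewrite -mulr_suml cF mul0r.
move/eqP: c0; apply; rewrite -c'E.
exact: (fb (fun i => c' i j0) _ (g0 j0 (ltn_ord j0))).
Qed.

Lemma key_inequality n m : (n + n <= m)%N ->
  (n.+1 * d n <= (d (m + k) - d m) * (d (n + k) - d n))%N.
Proof.
move=> nm; have dlt := d_strict n; set del := (d (n + k) - d n)%N.
have del0 : (0 < del)%N by rewrite subn_gt0.
have dn0 : (0 < d n)%N.
  rewrite lt0n; apply/eqP => dn0.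
  have /U_span [c e] : U n 1 by exact: U_mono U01.
  by have /eqP := oner_neq0 D; apply; rewrite e dn0 big_ord0.
(* The largest [p] with [p * del < d n], so that also [d n <= p.+1 * del]. *)
pose p := ((d n).-1 %/ del)%N.
have pd : (p * del < d n)%N.
  by rewrite -(prednK dn0) ltnS leq_divM.
have dp : (d n <= p.+1 * del)%N.
  by rewrite -{1}(prednK dn0) ltn_ceil.
have := rank_lower_bound pd nm.
move: (d (m + k) - d m)%N => del' h.
apply: leq_trans (leq_mul h (leqnn del)).
by rewrite [(p.+1 * _)%N]mulnC -mulnA leq_mul2l dp orbT.
Qed.
End KeyInequality.

(** * Cubic growth from the key inequality *)

Lemma sum_const_leq (F : nat -> nat) m n c :
  (forall i, (m <= i < n)%N -> (c <= F i)%N) -> ((n - m) * c <= \sum_(m <= i < n) F i)%N.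
Proof.
move=> h; rewrite -sum_nat_const_nat big_nat [leqRHS]big_nat.
exact: leq_sum.
Qed.

(* Summing over the box [J <= j < 2 J], [4 J <= i < 5 J] gives
   [J ^ 3 * a J <= a (5 J) ^ 2]; the constant [5 ^ 6] is reproduced by the induction. *)
Lemma cubic_growth (a : nat -> nat) :
  (forall i, (a i <= a i.+1)%N) -> (0 < a 1)%N ->
  (forall j i, (j + j <= i)%N -> (j * a j <= (a i.+1 - a i) * (a j.+1 - a j))%N) ->
  forall l, (5 ^ (3 * l) <= 5 ^ 6 * a (5 ^ l))%N.
Proof.
move=> amono a1 key.
have a_homo : {homo a : i j / (i <= j)%N} by apply: homo_leq; [exact: leqnn | exact: leq_trans |].
have tele m n : (m <= n)%N -> (\sum_(m <= i < n) (a i.+1 - a i) = a n - a m)%N.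
  by move=> mn; apply: telescope_sumn.
have step J : (J ^ 3 * a J <= a (5 * J) ^ 2)%N.
  have row j : (J <= j < 2 * J)%N ->
      (J * (J * a J) <= (a (5 * J) - a (4 * J)) * (a j.+1 - a j))%N.
    move=> /andP[Jj j2J]; rewrite -tele; last by lia.
    rewrite big_distrl /=; apply: leq_trans (_ : ((5 * J - 4 * J) * (J * a J) <= _)%N).
      by rewrite leq_mul2r; apply/orP; right; lia.
    apply: sum_const_leq => i /andP[i4 i5]; apply: leq_trans (key j i _); last by lia.
    by apply: leq_mul => //; apply: a_homo.
  have := sum_const_leq row; rewrite -big_distrr /= tele; last by lia.
  have : (a (5 * J) - a (4 * J) <= a (5 * J))%N by exact: leq_subr.
  have : (a (2 * J) - a J <= a (5 * J))%N.
    by apply: leq_trans (leq_subr _ _) (a_homo _ _ _); lia.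
  move=> h1 h2 h3; have := leq_mul h2 h1; move/(leq_trans h3).
  rewrite (_ : (2 * J - J)%N = J); last by lia.
  by rewrite -mulnn !expnS expn0 muln1 -!mulnA.
elim=> [|l IH]; first by rewrite muln0 !expn0 muln_gt0 expn_gt0 a1.
(* After squaring, with [J = 5 ^ l], the left side is [5 ^ 6 * J ^ 3 * J ^ 3]; the induction
   hypothesis bounds one factor [J ^ 3] by [5 ^ 6 * a J], and [step] bounds [J ^ 3 * a J]. *)
rewrite -(@leq_exp2r _ _ 2) //; have := step (5 ^ l)%N.
rewrite -expnS -expnM [(l * 3)%N]mulnC => st; rewrite expnMn.
apply: leq_trans (leq_mul (leqnn _) st).
have -> : ((5 ^ (3 * l.+1)) ^ 2 = 5 ^ 6 * (5 ^ (3 * l) * 5 ^ (3 * l)))%N.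
  by rewrite -expnM -!expnD; congr (5 ^ _)%N; lia.
move: IH; rewrite -[((5 ^ 6) ^ 2)%N]mulnn.
move: (5 ^ (3 * l))%N (a _) (5 ^ 6)%N => x y z h.
by rewrite -mulnA leq_mul2l [(z * (x * y))%N]mulnCA leq_mul2l h !orbT.
Qed.

(** * Spans of powers of a generating space and their dimensions *)

Section PowerSpan.
Variables (K : fieldType) (A : algType K).

Lemma in_spanE (t : seq A) a : in_span t a <-> kspan (size t) (fun i => t`_i) a.
Proof.
split=> [[c [sc ->]]|[k ->]]; first by exists (fun i => c`_i).
exists (mkseq k (size t)); rewrite size_mkseq; split => //.
by apply: eq_bigr => i _; rewrite nth_mkseq.
Qed.

Lemma in_span_mem (t : seq A) x : x \in t -> in_span t x.
Proof.
move=> xt; apply/in_spanE; rewrite -(nth_index 0 xt).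
by apply: (@kspan_gen _ _ _ (fun i => t`_i)); rewrite index_mem.
Qed.

Lemma in_span_sub (t t' : seq A) a :
  (forall x, x \in t -> in_span t' x) -> in_span t a -> in_span t' a.
Proof.
move=> tt' /in_spanE [k ->]; apply/in_spanE; apply: kspan_sum => i _; apply: kspanZ.
by apply/in_spanE; apply: tt'; apply: mem_nth.
Qed.

Lemma lin_indepE (t : seq A) : lin_indep t <-> kfree (size t) (fun i => t`_i).
Proof.
split=> [h k s0 i it|h c sc s0 i it]; last exact: h.
rewrite -(nth_mkseq 0 k it); apply: h => //; first by rewrite size_mkseq.
by rewrite -[RHS]s0; apply: eq_bigr => j _; rewrite nth_mkseq.
Qed.

(** A sublist chosen greedily is a basis, and its mask competes in the maximum that defines
    [dim_span]. *)
Lemma basis_of_span (t : seq A) : exists b : seq A,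
  [/\ (size b <= Defs.dim_span t)%N, kfree (size b) (fun i => b`_i)
    & forall a, in_span t a <-> in_span b a].
Proof.
suff [m [sm fm spm]] : exists m : bitseq, [/\ size m = size t,
    kfree (size (mask m t)) (fun i => (mask m t)`_i)
    & forall x, x \in t -> in_span (mask m t) x].
  exists (mask m t); split => //.
    rewrite size_mask //; have sm' : size m == size t by apply/eqP.
    apply: (@leq_bigmax_cond _ _ (fun m : (size t).-tuple bool => count id m) (Tuple sm')).
    by apply/asboolP/lin_indepE.
  move=> a; split; first exact: in_span_sub.
  by apply: in_span_sub => x /mem_mask; exact: in_span_mem.
elim: t => [|x t [m [sm fm spm]]].
  by exists [::]; split => // k _ i.
have [xm|xm] := pselect (in_span (mask m t) x).
  exists (false :: m); split => //=; first by rewrite sm.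
  by move=> y; rewrite inE => /orP[/eqP -> //|]; exact: spm.
exists (true :: m); split => /=; first by rewrite sm.
  move=> k; rewrite big_ord_recl /= => s0.
  have k0 : k 0%N = 0.
    apply: contrapT => /eqP k0; apply: xm; apply/in_spanE.
    rewrite -(scalerK k0 x); apply: kspanZ.
    move/eqP: s0; rewrite addr_eq0 => /eqP ->; rewrite -scaleN1r; apply: kspanZ.
    by exists (fun i => k i.+1).
  case=> [_ //|i]; rewrite ltnS => im.
  apply: (fm (fun i => k i.+1)) => //.
  by rewrite k0 scale0r add0r in s0.
move=> y; rewrite inE => /orP[/eqP ->|/spm]; first by apply: in_span_mem; rewrite inE eqxx.
by apply: in_span_sub => z zm; apply: in_span_mem; rewrite inE zm orbT.
Qed.

Lemma pow_span_mem (v : seq A) n (g : 'I_n -> 'I_(size v)) :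
  \prod_(i < n) v`_(g i) \in pow_span v n.
Proof.
apply/mapP; exists [ffun i => g i]; first by rewrite mem_enum.
by apply: eq_bigr => i _; rewrite ffunE.
Qed.

Lemma pow_span1 (v : seq A) a : in_span v a -> in_span (pow_span v 1) a.
Proof.
apply: in_span_sub => x xv; apply: in_span_mem.
have ix : (index x v < size v)%N by rewrite index_mem.
have := pow_span_mem (fun _ : 'I_1 => Ordinal ix).
by rewrite big_ord1 /= nth_index.
Qed.

Lemma pow_span0 (v : seq A) : in_span (pow_span v 0) 1.
Proof.
have noI (i : 'I_0) : 'I_(size v) by case: i.
by apply: in_span_mem; have := pow_span_mem noI; rewrite big_ord0.
Qed.

Lemma pow_spanM (v : seq A) m n a b :
  in_span (pow_span v m) a -> in_span (pow_span v n) b ->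
  in_span (pow_span v (m + n)) (a * b).
Proof.
move=> /in_spanE [k ->] /in_spanE [l ->]; apply/in_spanE.
rewrite mulr_suml; apply: kspan_sum => i _.
rewrite mulr_sumr; apply: kspan_sum => j _.
rewrite -scalerAl -scalerAr; apply: kspanZ; apply: kspanZ; apply/in_spanE; apply: in_span_mem.
have /mapP[g _ ->] := mem_nth 0 (ltn_ord i); have /mapP[h _ ->] := mem_nth 0 (ltn_ord j).
have := pow_span_mem (fun x : 'I_(m + n) => match split x with inl y => g y | inr y => h y end).
rewrite big_split_ord /=.
under eq_bigr => x _ do rewrite (unsplitK (inl x)).
by under [X in _ * X \in _ -> _]eq_bigr => x _ do rewrite (unsplitK (inr x)).
Qed.

(** The upper limit is an infimum of suprema over tails, so some tail already has its supremum below
    [c]. *)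
Lemma GKdim_lt_dim_pow (v : seq A) (c : Rdefinitions.R) : (GKdim_wrt v < c%:E)%E ->
  exists r : Rdefinitions.R, r < c /\ exists N, forall n, (N <= n)%N -> (1 < n)%N ->
    ln ((dim_pow v n)%:R : Rdefinitions.R) <= r * ln n%:R.
Proof.
move=> lt; have [V [[N _ NV] Vlt]] : exists V : set nat, eventually V /\
    (ereal_sup [set ((ln ((dim_pow v n)%:R : Rdefinitions.R)) / ln (n%:R : Rdefinitions.R))%:E
       | n in V]%classic < c%:E)%E.
  apply: contrapT => no; move: lt; rewrite ltNge => /negP; apply.
  apply: le_ereal_inf_tmp => _ [V ooV <-]; rewrite leNgt; apply/negP => h.
  by apply: no; exists V.
have [r [rc supr]] : exists r : Rdefinitions.R, r < c /\
   (ereal_sup [set ((ln ((dim_pow v n)%:R : Rdefinitions.R)) / ln (n%:R : Rdefinitions.R))%:E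
       | n in V]%classic <= r%:E)%E.
  move: Vlt; case: (ereal_sup _) => [r||] // h.
    by exists r; split => //; rewrite -lte_fin.
  (* Here the supremum is minus infinity, and any real below [c] serves. *)
  by exists (c - 1); split; [rewrite ltrBlDr ltrDl | rewrite leNye].
exists r; split => //; exists N => n Nn n1.
have lnn : 0 < ln (n%:R : Rdefinitions.R) by apply: ln_gt0; rewrite ltr1n.
rewrite -ler_pdivrMr // -lee_fin; apply: le_trans supr.
by apply: ereal_sup_ubound; exists n => //; apply: NV.
Qed.

End PowerSpan.

(** Taking logarithms at [k * 5 ^ l], the two bounds give [(3 - r) * ln 5 * l <= 6 * ln 5 + r * ln
    k], false for large [l]. *)
Lemma cubic_not_subcubic (N : nat -> nat) (k : nat) (r : Rdefinitions.R) n0 :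
  (0 < k)%N -> r < 3 ->
  (forall n, (n0 <= n)%N -> (1 < n)%N -> ln ((N n)%:R : Rdefinitions.R) <= r * ln n%:R) ->
  ~ (forall l, (5 ^ (3 * l) <= 5 ^ 6 * N (k * 5 ^ l))%N).
Proof.
move=> k0 r3 up low.
pose c : Rdefinitions.R := ln 5; pose q : Rdefinitions.R := ln k%:R.
have c0 : 0 < c by apply: ln_gt0; rewrite (ltr1n _ 5).
have e0 : 0 < (3 - r) * c by apply: mulr_gt0 => //; rewrite subr_gt0.
(* [Num.bound t] defeats the logarithmic inequality, and [n0 + 2] brings [k * 5 ^ l] into the range
   of [up]. *)
pose t := `|((3 - r) * c)^-1 * (6 * c + r * q)|; pose l := (Num.bound t + (n0 + 2))%N.
have lb : (6 * c + r * q) < (3 - r) * c * l%:R.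
  rewrite -ltr_pdivrMl //; apply: le_lt_trans (ler_norm _) _.
  apply: lt_le_trans (archi_boundP (normr_ge0 _)) _.
  by rewrite /l natrD lerDl ler0n.
have l5 : (l < 5 ^ l)%N by apply: ltn_expl.
have nl : (l <= k * 5 ^ l)%N by apply: leq_trans (ltnW l5) _; rewrite leq_pmull.
have n1 : (1 < k * 5 ^ l)%N by apply: leq_trans nl; rewrite /l; lia.
have n0n : (n0 <= k * 5 ^ l)%N by apply: leq_trans nl; rewrite /l; lia.
have Npos : (0 < N (k * 5 ^ l))%N.
  by rewrite lt0n; apply: contraTneq (low l) => ->; rewrite muln0 -ltnNge expn_gt0.
have := up _ n0n n1.
have k0R : (0 : Rdefinitions.R) < k%:R by rewrite ltr0n.
have R5 n : (0 : Rdefinitions.R) < 5 ^+ n by rewrite exprn_gt0 // (ltr0n _ 5).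
have lnn : ln ((k * 5 ^ l)%N%:R : Rdefinitions.R) = q + c * l%:R.
  by rewrite natrM natrX lnM ?posrE // lnXn ?(ltr0n _ 5) // mulr_natr.
rewrite lnn.
have NR : (0 : Rdefinitions.R) < (N (k * 5 ^ l)%N)%:R by rewrite ltr0n.
have : ln (5 ^+ (3 * l) : Rdefinitions.R) <= ln (5 ^+ 6 * (N (k * 5 ^ l)%N)%:R).
  rewrite ler_ln ?posrE ?mulr_gt0 //.
  by have := low l; rewrite -(ler_nat Rdefinitions.R) natrM !natrX.
rewrite lnM ?posrE // !lnXn ?(ltr0n _ 5) // -/c -[c *+ (3 * l)]mulr_natr natrM -[c *+ 6]mulr_natr.
move: (ln _) lb => x; move: (l%:R) => y lb h1 h2.
have : c * (3%:R * y) <= c * 6 + r * (q + c * y) by lra.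
nra.
Qed.

(** * Denominators and generators in the quotient division algebra *)

Section Quotient.
Variables (K : fieldType) (A : algType K) (D : unitAlgType K).

Lemma pow_span_leq (v : seq A) m n a :
  in_span v 1 -> (m <= n)%N -> in_span (pow_span v m) a -> in_span (pow_span v n) a.
Proof.
move=> v1 mn am; rewrite -(subnKC mn); elim: (n - m)%N => [|i IH]; first by rewrite addn0.
by rewrite addnS -addn1 -[a]mulr1; apply: pow_spanM IH _; apply: pow_span1.
Qed.

Lemma pow_span_exhaust (v : seq A) a :
  in_span v 1 -> generates v -> exists n, in_span (pow_span v n) a.
Proof.
move=> v1 gen; apply: (gen (fun a => exists n, in_span (pow_span v n) a)) => {a}; last first.
  by move=> x xv; exists 1%N; apply: pow_span1.
split; first by exists 0%N; apply: pow_span0.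
split=> [x y [m xm] [n yn]|].
  exists (m + n)%N; apply/in_spanE; apply: kspanD; apply/in_spanE.
    by apply: pow_span_leq xm => //; rewrite leq_addr.
  by apply: pow_span_leq yn => //; rewrite leq_addl.
split=> [x y [m xm] [n yn]|k x [n xn]]; first by exists (m + n)%N; apply: pow_spanM.
by exists n; apply/in_spanE; apply: kspanZ; apply/in_spanE.
Qed.

Variable f : {lrmorphism A -> D}.
Hypothesis QA : is_quotient_division_alg f.

Lemma common_denominator (w : seq D) :
  exists s, f s != 0 /\ forall x, x \in w -> exists a, x * f s = f a.
Proof.
have [divD [_ fracD]] := QA.
elim: w => [|x w [s [s0 sw]]]; first by exists 1; rewrite rmorph1 oner_neq0.
(* Writing [(f c)^-1 * f s] as a right fraction gives [f s * f t = f c * f p], a common right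
   multiple of the old denominator [s] and the denominator [c] of [x]. *)
have [b [c [c0 xE]]] := fracD x; have [p [t [t0 csE]]] := fracD ((f c)^-1 * f s).
have st : f (s * t) = f c * f p.
  rewrite rmorphM; apply: (canRL (mulVKr (divD _ c0))).
  by rewrite mulrA csE divrK // divD.
exists (s * t); split.
  by rewrite rmorphM; apply: (nzd_mulf_neq0 (division_nzd divD)).
move=> y; rewrite inE => /orP[/eqP ->|/sw [a aE]].
  by exists (b * p); rewrite st xE !mulrA divrK ?divD // rmorphM.
by exists (a * t); rewrite !rmorphM mulrA aE.
Qed.

Lemma common_denominator_filtration (v : seq A) (w : seq D) :
  in_span v 1 -> generates v ->
  exists s k, f s != 0 /\
    forall x, x \in w -> exists a, in_span (pow_span v k) a /\ x * f s = f a.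
Proof.
move=> v1 gen; have [s [s0 sw]] := common_denominator w; exists s.
suff [k wk] : exists k, forall x, x \in w ->
    exists a, in_span (pow_span v k) a /\ x * f s = f a by exists k.
elim: w sw => [|x w IH] sw; first by exists 0%N.
have [|k wk] := IH; first by move=> y yw; apply: sw; rewrite inE yw orbT.
have [a aE] := sw x (mem_head _ _); have [n an] := pow_span_exhaust a v1 gen.
exists (n + k)%N => y; rewrite inE => /orP[/eqP ->|/wk [b [bk bE]]].
  by exists a; split => //; apply: pow_span_leq an => //; rewrite leq_addr.
by exists b; split => //; apply: pow_span_leq bk => //; rewrite leq_addl.
Qed.

Lemma quotient_gen (v : seq A) (T : D -> Prop) :
  generates v -> is_divsubalg T -> (forall a, in_span v a -> T (f a)) -> forall x, T x.
Proof.
move=> gen subT vT x; have [_ [_ fracD]] := QA.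
have fT a : T (f a).
  apply: (gen (fun a => T (f a))) => //; have [Tk [TD [_ [TM _]]]] := subT.
  split; first by rewrite rmorph1 -[1]scale1r.
  split=> [y z|]; first by rewrite rmorphD; exact: TD.
  split=> [y z|k y Ty]; first by rewrite rmorphM; exact: TM.
  by rewrite linearZ /= -mulr_algl; apply: TM.
have [a [s [s0 ->]]] := fracD x; have [_ [_ [_ [TM TV]]]] := subT.
by apply: TM => //; apply: TV.
Qed.

Lemma lrmorphism_kspan n (b : nat -> A) x :
  (exists a, kspan n b a /\ x = f a) <-> kspan n (fun i => f (b i)) x.
Proof.
have fE (k : nat -> K) : f (\sum_(i < n) k i *: b i) = \sum_(i < n) k i *: f (b i).
  by rewrite linear_sum; apply: eq_bigr => i _; rewrite linearZ.
split=> [[a [[k ->] ->]]|[k ->]]; first by exists k.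
by exists (\sum_(i < n) k i *: b i); split=> //; exists k.
Qed.

Lemma lrmorphism_kfree n (b : nat -> A) : kfree n b -> kfree n (fun i => f (b i)).
Proof.
move=> fb k s0; apply: fb; have [_ [injf _]] := QA; apply: injf.
by rewrite raddf0 -[RHS]s0 linear_sum; apply: eq_bigr => i _; rewrite linearZ.
Qed.

End Quotient.

(** Vectors independent over [F] are independent over [K], as [F] contains the scalars [k%:A]. *)
Lemma infinite_kfree (K : fieldType) (D : unitAlgType K) (F E : D -> Prop) n :
  is_division_ring D -> is_divsubalg F -> ~ left_findim F E ->
  exists g : nat -> D, kfree n g /\ forall i, (i < n)%N -> E (g i).
Proof.
move=> divD subF inf; have [h [th hE]] := infinite_triangular inf n; exists h; split => //.
have [Fk _] := subF => k s0 i ij.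
have := triangular_lfree divD subF th (c := fun i => (k i)%:A) (fun i => Fk (k i)).
move=> /(_ _ i ij) k0; apply/eqP; have /eqP := k0 (etrans (eq_bigr _ (fun j _ => mulr_algl _ _)) s0).
by rewrite scaler_eq0 oner_eq0 orbF.
Qed.

Unset Implicit Arguments.

Theorem theorem1p2 (K : fieldType) (A : algType K) (D : unitAlgType K)
  (f : {lrmorphism A -> D})
  (A_dom : is_domain A)
  (A_GK : exists v : seq A, in_span v 1 /\ generates v /\ (GKdim_wrt v < 3%:E)%E)
  (QA : is_quotient_division_alg f)
  (m : nat) (Dc : nat -> D -> Prop)
  (D0 : forall x, Dc 0%N x <-> exists k : K, x = k%:A)
  (Dsub : forall i, (i <= m)%N -> is_divsubalg (Dc i))
  (Dchain : forall i, (1 <= i <= m)%N -> forall x, Dc i.-1 x -> Dc i x)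
  (Dinf : forall i, (1 <= i <= m)%N -> ~ left_findim (Dc i.-1) (Dc i))
  (Dfg : forall i, (1 <= i <= m)%N -> fg_division_alg (Dc i)) :
  (m <= 2)%N.
Proof.
rewrite leqNgt; apply/negP => m3; have divD := QA.1.
have [m0 [m1 m2]] : (0 < m)%N /\ (1 < m)%N /\ (2 < m)%N by lia.
have [v [v1 [gen GK]]] := A_GK.
have [subE1 [S1 [SE1 gen1]]] : fg_division_alg (Dc 1) by apply: Dfg.
have [subE2 [S2 [SE2 gen2]]] : fg_division_alg (Dc 2) by apply: Dfg.
have E12 : forall x, Dc 1%N x -> Dc 2 x by apply: (Dchain 2).
have inf1 n := infinite_kfree n divD (Dsub 0%N isT) (Dinf 1%N m0).
have inf2 : ~ left_findim (Dc 1) (Dc 2) by apply: (Dinf 2).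
have inf3 : ~ left_findim (Dc 2) (Dc 3) by apply: (Dinf 3).
have [b bP] := choice (fun n => basis_of_span (pow_span v n)).
pose U n x := exists a, in_span (pow_span v n) a /\ x = f a.
pose d n := size (b n); pose beta n i := f (b n)`_i.
have U_span n x : U n x <-> kspan (d n) (beta n) x.
  have [_ _ bE] := bP n; rewrite -(lrmorphism_kspan f (d n) (fun i => (b n)`_i)).
  by split=> -[a [/= h ->]]; exists a; split => //; move: h => /=;
     [move/bE/in_spanE | move/in_spanE/bE].
have beta_free n : kfree (d n) (beta n).
  by have [_ fb _] := bP n; exact: (lrmorphism_kfree QA fb).
have U01 : U 0%N 1 by exists 1; rewrite rmorph1; split=> //; apply: pow_span0.
have UM i j x y : U i x -> U j y -> U (i + j)%N (x * y).
  move=> [a [ai ->]] [c [cj ->]]; exists (a * c); rewrite rmorphM; split => //.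
  exact: pow_spanM.
have U_mono i j x : (i <= j)%N -> U i x -> U j x.
  by move=> ij [a [ai ->]]; exists a; split=> //; apply: pow_span_leq ai.
have U_gen T : is_divsubalg T -> (forall x, U 1%N x -> T x) -> forall x, T x.
  move=> subT UT; apply: (quotient_gen QA gen subT) => a av; apply: UT.
  by exists a; split => //; apply: pow_span1.
have [s [k [s0 sw]]] := common_denominator_filtration QA (1 :: S1 ++ S2) v1 gen.
have strict := d_strict divD U_span beta_free U01 UM U_mono subE1 SE1 gen1 inf1 s0 sw.
have key := @key_inequality _ _ divD _ _ _ U_span beta_free U01 UM U_mono U_gen _ _ _ _ _
  subE1 subE2 E12 SE1 SE2 gen1 gen2 inf1 inf2 inf3 _ _ s0 sw.
have k0 : (0 < k)%N by rewrite lt0n; apply: contraTneq (strict 0%N) => ->; rewrite ltnn.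
(* Sampling at multiples of [k] turns the increments [d (n + k) - d n] into differences of
   consecutive terms, as [cubic_growth] expects. *)
pose a j := d (k * j)%N.
have aS i : a i.+1 = d (k * i + k)%N by rewrite /a mulnSr.
have [r [r3 [N up]]] := GKdim_lt_dim_pow GK.
apply: (cubic_not_subcubic k0 r3 up) => l.
apply: leq_trans (@cubic_growth a _ _ _ l) _.
- by move=> i; rewrite aS; apply: ltnW (strict _).
- by rewrite aS; apply: leq_ltn_trans (strict _).
- move=> j i ji; rewrite !aS; apply: leq_trans (key (k * j) (k * i) _)%N.
    (* The key inequality at [k * j] has the factor [(k * j).+1], which is at least [j]. *)
    by rewrite leq_mul2r; apply/orP; right; apply: leq_trans (leqnSn _); rewrite leq_pmull.
  by rewrite -mulnDr leq_mul2l ji orbT.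
(* The bases chosen by [basis_of_span] have size at most [dim_pow], which carries the cubic lower
   bound over to it. *)
rewrite leq_mul2l; apply/orP; right.
by have [] := bP (k * 5 ^ l)%N.
Qed.
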